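(* Let $\lambda>0$ and let $f:\mathbb{R}\times\{\pm1\}\to\mathbb{C}$ be a function which is $C_0$ in the first entry, that is, $f(\cdot,\pm1)$ is continuous with $\lim_{y\to\pm\infty}|f(y,\pm1)|=0$. Let $\psi(t,y,z)=e^{\lambda t}\,\mathbb{E}\left[i^{N_t}f\big(y-z\int_0^t(-1)^{N_s}ds,\ z(-1)^{N_t}\big)\right]$ for $t\ge0$, $y\in\mathbb{R}$, $z\in\{\pm1\}$, where $(N_t)_{t\ge0}$ is a Poisson process of intensity $\lambda$ with $N_0=0$, and write $\psi_\pm(t,y)=\psi(t,y,\pm1)$. Then $\psi$ is a solution to the linear system of PDEs $$\begin{cases}\partial_t\psi_+=-\partial_y\psi_++i\lambda\psi_-,\\ \partial_t\psi_-=\partial_y\psi_-+i\lambda\psi_+,\end{cases}$$ with $\psi(0,y,z)=f(y,z)$. Additionally, the following conservation property holds: for every $t>0$, $$\int_{-\infty}^\infty\big(|\psi_+(t,y)|^2+|\psi_-(t,y)|^2\big)dy=1$$ whenever $\int_{-\infty}^\infty\big(|f(y,1)|^2+|f(y,-1)|^2\big)dy=1$.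
   Context: The function $\psi$ arises as the pointwise limit $\lim_{\epsilon\to0}\psi^\epsilon_{\lfloor t/\epsilon\rfloor}(\lfloor y/\epsilon\rfloor,z)$ for $t>0$, where $\psi^\epsilon_n$ is the $n$-th step state of the quantum walk on $\mathbb{Z}$ with homogeneous coin $e^{i\epsilon\lambda\sigma_1}$ ($\sigma_1$ the Pauli-X matrix) started from the state $\psi_0^\epsilon(x,z)=f(\epsilon x,z)$ in $\ell^2(\mathbb{Z}\times\{\pm1\})$ (not necessarily normalized); this limit equals the probabilistic formula displayed in the claim, which is all that is needed to read the statement.
   Formalization: For f merely C_0 the partial derivatives of ψ need not exist (e.g. f(y,1)=max(0,1-|y|), f(y,-1)=0), so ψ is shown to be a continuous weak solution for every such f, and to satisfy the system pointwise for t>0 when f(·,±1) is also C^1. *)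

(* Defs.v *)
From HB Require Import structures.
From mathcomp Require Import all_boot all_order all_algebra.
From mathcomp Require Import complex.
From mathcomp Require Import all_classical all_reals all_analysis.

Set Implicit Arguments.
Unset Strict Implicit.
Unset Printing Implicit Defensive.

Import Order.TTheory GRing.Theory Num.Theory.
Import numFieldNormedType.Exports.

Local Open Scope classical_set_scope.
Local Open Scope ring_scope.
Local Open Scope complex_scope.

(* The set {+1, -1} is represented by bool, b standing for the sign (-1) ^+ b:
   false is +1 and true is -1.  Hence multiplying the sign b by (-1) ^+ n gives
   the sign b (+) odd n. *)

(* A Poisson process of intensity lambda started at 0, indexed by the times
   t >= 0 (the values of N at negative times are irrelevant). *)
Record poisson_process (R : realType) d (Omega : measurableType d)
    (P : probability Omega R) (lambda : R) (N : R -> {RV P >-> nat}) : Prop :=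
  PoissonProcess {
    poisson_start : forall w, N 0 w = 0%N ;
    poisson_nondecreasing : forall w s t, 0 <= s -> s <= t -> (N s w <= N t w)%N ;
    poisson_right_continuous :
      forall w t, 0 <= t -> N s w @[s --> t^'+] --> N t w ;
    (* mutual independence of the increments over any subdivision
       0 <= t 0 <= ... <= t n *)
    poisson_independent_increments :
      forall (n : nat) (t : nat -> R),
        0 <= t 0%N -> {homo t : i j / (i <= j)%N >-> i <= j} ->
        forall A : nat -> set nat,
          P (\bigcap_(i < n) [set w | A i (N (t i.+1) w - N (t i) w)%N]) =
          (\prod_(i < n) P [set w | A i (N (t i.+1) w - N (t i) w)%N])%E ;
    poisson_increment :
      forall s t, 0 <= s -> s < t -> forall k : nat,
        P [set w | (N t w - N s w)%N = k] =
        (poisson_pmf (lambda * (t - s)) k)%:E }.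

(* Integral of a complex-valued function. *)
Definition cintegral (R : realType) d (T : measurableType d)
    (mu : {measure set T -> \bar R}) (D : set T) (g : T -> R[i]) : R[i] :=
  (\int[mu]_(x in D) complex.Re (g x)) +i* (\int[mu]_(x in D) complex.Im (g x)).

(* R[i] is not a normed module over R in the library, so the derivative of a
   complex-valued function of a real variable is taken componentwise. *)
Definition is_cderive (R : realType) (g : R -> R[i]) (x : R) (l : R[i]) : Prop :=
  is_derive x 1 (fun y => complex.Re (g y)) (complex.Re l) /\
  is_derive x 1 (fun y => complex.Im (g y)) (complex.Im l).

Definition C1_fun (R : realType) (g : R -> R[i]) : Prop :=
  exists2 g' : R -> R[i]^o, continuous g' & forall x, is_cderive g x (g' x).

Definition C0_fun (R : realType) (g : R -> R[i]^o) : Prop :=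
  [/\ continuous g,
      Normc.normc (g y) @[y --> +oo] --> (0 : R) &
      Normc.normc (g y) @[y --> -oo] --> (0 : R)].

Definition psi (R : realType) d (Omega : measurableType d)
    (P : probability Omega R) (lambda : R) (N : R -> {RV P >-> nat})
    (f : R -> bool -> R[i]) (t y : R) (b : bool) : R[i] :=
  (expR (lambda * t))%:C *
  cintegral P setT (fun w =>
    'i ^+ N t w *
    f (y - (-1) ^+ b *
           \int[lebesgue_measure]_(s in `[0, t]) ((-1) ^+ N s w : R))
      (b (+) odd (N t w))).

Section PDE.
Variable R : realType.
Implicit Types (lambda : R) (f : R -> bool -> R[i]) (u : R -> R -> bool -> R[i]).

Definition classical_solution lambda u : Prop :=
  forall t y, 0 < t ->
    exists dt dy : bool -> R[i],
      [/\ forall b, is_cderive (fun s => u s y b) t (dt b),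
          forall b, is_cderive (fun x => u t x b) y (dy b),
          dt false = - dy false + 'i * lambda%:C * u t y true &
          dt true = dy true + 'i * lambda%:C * u t y false].

Definition d_t (phi : R -> R -> R) (t y : R) : R := derive1 (fun s => phi s y) t.
Definition d_y (phi : R -> R -> R) (t y : R) : R := derive1 (fun x => phi t x) y.

(* C^1 functions with compact support in R x R; the support may meet the line
   t = 0. *)
Definition test_function (phi : R -> R -> R) : Prop :=
  [/\ forall t y, derivable (fun s => phi s y) t 1 /\
                  derivable (fun x => phi t x) y 1,
      continuous (fun p : R * R => d_t phi p.1 p.2),
      continuous (fun p : R * R => d_y phi p.1 p.2) &
      exists M : R, forall t y, M < `|t| \/ M < `|y| -> phi t y = 0].

Local Notation Int_R := (cintegral lebesgue_measure setT).
Local Notation Int_0oo := (cintegral lebesgue_measure `[0, +oo[).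

(* Continuous weak solutions, on [0, +oo[ x R, of the Cauchy problem
     d_t u_+ = - d_y u_+ + i lambda u_-,    d_t u_- = d_y u_- + i lambda u_+,
     u(0, ., .) = f :
   both equations are multiplied by a test function, and the derivatives of u
   are moved onto it by integration by parts over [0, +oo[ x R. *)
Definition weak_solution lambda f u : Prop :=
  (forall b, {within [set p : R * R | 0 <= p.1],
                continuous (fun p : R * R => u p.1 p.2 b : R[i]^o)}) /\
  forall phi, test_function phi ->
    Int_0oo (fun t => Int_R (fun y =>
      u t y false * (d_t phi t y + d_y phi t y)%:C +
      'i * lambda%:C * u t y true * (phi t y)%:C)) +
    Int_R (fun y => f y false * (phi 0 y)%:C) = 0
    /\
    Int_0oo (fun t => Int_R (fun y =>
      u t y true * (d_t phi t y - d_y phi t y)%:C +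
      'i * lambda%:C * u t y false * (phi t y)%:C)) +
    Int_R (fun y => f y true * (phi 0 y)%:C) = 0.

End PDE.

(* Main.v *)
Require Import Defs.
From HB Require Import structures.
From mathcomp Require Import all_boot all_order all_algebra.
From mathcomp Require Import complex.
From mathcomp Require Import all_classical all_reals all_analysis.
From mathcomp Require Import measurable_realfun.
From mathcomp Require Import ring lra.

Import Order.TTheory GRing.Theory Num.Theory.
Import numFieldNormedType.Exports.

Local Open Scope classical_set_scope.
Local Open Scope ring_scope.
Local Open Scope complex_scope.

(** Multiplication by i exchanges real and imaginary parts up to a sign, and a
    jump of the Poisson process exchanges the two chiralities.  In
    i^N f(., z (-1)^N) both happen at the same time, so the complex system
    splits into two independent real ones, indexed by a boolean e: part p of
    component b belongs to system e when p = ~~ (b (+) e).  Each real system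
    has the same shape: components b and ~~ b are transported with opposite
    speeds [sg b], [sg (~~ b)] and coupled by lambda times the opposite signs
    [turn e b], [turn e (~~ b)].  Nearly everything is proved for one real
    system, whose process formula is [real_psi].

    The law of the process is given by its increments over finite grids,
    so it is sampled with mesh h.  Under the expectation only the residues
    modulo 4 of the increments matter, since the phase has period 4; for a
    Poisson variable of parameter x, these residues recombine into
    e^(-x) cos x and e^(-x) sin x ([residues_cos_sin]).  By independence, the
    sampled formula is exactly a quantum walk, a product of the rotations by
    lambda h and the translations by h ([expectation_walk]).  The sampled
    displacement differs from the true one by at most 2 h N_t, because a cell
    of the grid contributes only if the path jumps in it
    ([grid_displacement_dist_le]).  Hence the walks converge pointwise to
    [real_psi] ([walk_cvg]).

    The walk is elementary, and two of its properties survive in the limit.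
    Telescoping it along a characteristic gives the Duhamel formula
      v_b(t, x + sg b t) = g_b(x) + turn_b lambda int_0^t v_(~~ b)(r, x + sg b r) dr
    ([duhamel]); with the continuity in space it gives joint continuity and the
    derivative along characteristics ([psi_ext_continuous],
    [psi_ext_characteristic]).  Since one step of the walk is made of
    translations and a rotation, it preserves the energy, up to propagation
    at finite speed when the energy is localized on [-A, A]; in the limit, the
    energy in [-A, A] at one time is at most the energy in [-(A+t), A+t] at the
    other, in both directions of time ([energy_psi_le], [energy_psi_ge]), and
    letting A tend to infinity gives the conservation law.

    For C^1 data, the derivative in time is obtained by subtracting the
    derivative in space from the one along the characteristic
    ([derive_slant]).  For the weak formulation, the integral over x of
    v phi, taken at the position x + sg b t, is differentiated in t under the
    integral sign: at fixed x, this follows a characteristic, along which v has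
    a derivative even when it has none at fixed position.  Integrating the
    result from 0 to a time where phi vanishes leaves the initial term
    ([real_weak]). *)

Set Implicit Arguments.
Unset Strict Implicit.
Unset Printing Implicit Defensive.

(** * Real walks and Poisson paths *)

Section Walk.
Context {R : realType}.

Definition sg (b : bool) : R := (-1) ^+ b.

Lemma sgN b : sg (~~ b) = - sg b.
Proof. by case: b; rewrite /sg /= ?expr0 ?expr1 ?opprK. Qed.

Lemma sg2 b : sg b * sg b = 1.
Proof. by case: b; rewrite /sg /= ?expr0 ?expr1 ?mulr1 ?mulrNN ?mulr1. Qed.

Lemma sgD b c : sg (b (+) c) = sg b * sg c.
Proof. by rewrite /sg signr_addb. Qed.

Lemma sg_norm b : `|sg b| = 1.
Proof. by rewrite /sg normrX normrN1 expr1n. Qed.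

Lemma sg_odd k : sg (odd k) = (-1) ^+ k.
Proof. by rewrite /sg signr_odd. Qed.

Variable e : bool.

(** Sign of the coupling of the real system e: multiplication by i takes
    part ~~ p to part p with the sign (-1) ^+ (~~ p), and p = ~~ (b (+) e). *)
Definition turn (b : bool) : R := sg (b (+) e).

Lemma turnN b : turn (~~ b) = - turn b.
Proof. by rewrite /turn addNb sgN. Qed.

Lemma turn2 b : turn b * turn b = 1. Proof. exact: sg2. Qed.

Lemma turn_norm b : `|turn b| = 1. Proof. exact: sg_norm. Qed.

(** Sign picked up after k jumps from chirality b, that is, the real shadow of
    i ^ k; see [cpart_expi]. *)
Fixpoint phase (b : bool) (k : nat) : R :=
  if k is k'.+1 then turn b * phase (~~ b) k' else 1.

Lemma phaseD b j k : phase b (j + k) = phase b j * phase (b (+) odd j) k.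
Proof.
elim: j b => [|j IH] b; first by rewrite add0n /= addbF mul1r.
by rewrite addSn /= IH mulrA addNb addbN.
Qed.

Lemma phase_norm b k : `|phase b k| = 1.
Proof.
elim: k b => [|k IH] b /=; first by rewrite normr1.
by rewrite normrM turn_norm IH mulr1.
Qed.

Lemma phaseS2 b k : phase b k.+2 = - phase b k.
Proof. by rewrite /= negbK turnN mulrA mulrN turn2 mulN1r. Qed.

Lemma phase_mod4 b k : phase b k = phase b (k %% 4).
Proof.
rewrite [in LHS](divn_eq k 4); elim: (k %/ 4)%N => [|q IH].
  by rewrite mul0n add0n.
rewrite mulSn -addnA -IH.
by rewrite !(addSn, add0n) !phaseS2 opprK.
Qed.

Variable h : R.

(** One step translates each chirality by h in its own direction, then rotates
    the pair of chiralities by the angle a. *)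
Fixpoint walk (a : R) (n : nat) (g : R -> bool -> R) (y : R) (b : bool) : R :=
  if n is n'.+1 then
    cos a * walk a n' g (y - sg b * h) b +
    turn b * sin a * walk a n' g (y + sg b * h) (~~ b)
  else g y b.

(** The sampled formula, read from a list of increments of the process: every
    cell shifts the position by h, according to the chirality reached at its end.
    Peeling off the first increment leaves a value of the same form, which is
    the recursion of [walk] before averaging over that increment. *)
Fixpoint path_value (n : nat) (X : nat -> nat) (g : R -> bool -> R) (y : R)
    (b : bool) : R :=
  if n is n'.+1 then
    phase b (X 0%N) *
    path_value n' (fun i => X i.+1) g
      (y - sg (b (+) odd (X 0%N)) * h) (b (+) odd (X 0%N))
  else g y b.

(** Undoes the recursion: only the partial sums of the increments, hence the
    process itself, are visible in the closed form. *)
Lemma path_valueE n X g y b :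
  path_value n X g y b =
  let S k := (\sum_(i < k) X i)%N in
  phase b (S n) *
  g (y - sg b * (h * \sum_(k < n) (-1) ^+ S k.+1)) (b (+) odd (S n)).
Proof.
elim: n X y b => [|n IH] X y b /=.
  by rewrite !big_ord0 mulr0 mulr0 subr0 mul1r addbF.
rewrite IH /=.
have E k : (\sum_(i < k.+1) X i = X 0 + \sum_(i < k) X i.+1)%N.
  by rewrite big_ord_recl.
rewrite E phaseD mulrA; congr (_ * g _ _); last by rewrite oddD addbA.
under [in RHS]eq_bigr => k _ do rewrite E exprD.
rewrite -mulr_sumr [in RHS]big_ord_recl big_ord0 expr0 sgD -sg_odd.
set s := sg b; set s' := sg (odd _); set q := (\sum_(k < n) _).
by ring.
Qed.

Lemma path_value_eq n X X' g y b : (forall i, (i < n)%N -> X i = X' i) ->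
  path_value n X g y b = path_value n X' g y b.
Proof.
elim: n X X' y b => //= n IH X X' y b XX'.
by rewrite XX'//; congr (_ * _); apply: IH => i ?; apply: XX'.
Qed.

End Walk.

(** * Residues of a Poisson variable modulo 4 *)

Section Residues.
Context {R : realType} d {Omega : measurableType d} (P : probability Omega R).

(** Countable additivity, with the factor e^(-x) of the Poisson weights moved to
    the other side so that the partial sums are those of power series. *)
Lemma cvg_prob_of_pmf (X : Omega -> nat) (x : R) (B : set nat) :
  0 < x ->
  (forall k, measurable [set w | X w = k]) ->
  (forall k, P [set w | X w = k] = (poisson_pmf x k)%:E) ->
  \sum_(0 <= k < n) ((k \in B)%:R * (x ^+ k * k`!%:R^-1)) @[n --> \oo] -->
    expR x * fine (P [set w | B (X w)]).
Proof.
move=> x0 mX PX.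
pose F k := [set w | X w = k /\ B k].
have FE k : F k = if k \in B then [set w | X w = k] else set0.
  rewrite /F; case: ifPn => [/set_mem Bk|/negP Bk]; apply/seteqP; split=> w //=.
    by case.
  by case=> _ Bk'; apply: Bk; exact/mem_set.
have mF k : measurable (F k) by rewrite FE; case: ifP.
have UF : \bigcup_k F k = [set w | B (X w)].
  apply/seteqP; split=> w /=; first by case=> k _ [<-].
  by move=> BX; exists (X w).
have tF : trivIset setT F by move=> i j _ _ [w /= [[<- _] [-> _]]].
have mU : measurable (\bigcup_k F k) by exact: bigcupT_measurable.
have := @measure_semi_sigma_additive _ _ _ P F mF tF mU.
rewrite UF => cP.
have c2 : (fine (\sum_(0 <= i < n) P (F i))%E) @[n --> \oo] -->
    fine (P [set w | B (X w)]).
  apply: fine_cvg; rewrite fineK//.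
  by rewrite fin_num_measure// -UF.
rewrite (_ : (fun n => _) =
    (fun n => expR x * fine (\sum_(0 <= i < n) P (F i))%E)).
  exact: cvgM (cvg_cst _) c2.
apply/funext => n.
rewrite -sum_fine; last by move=> i _; rewrite fin_num_measure.
rewrite mulr_sumr; apply: eq_bigr => k _.
rewrite FE; case: ifPn => kB; last by rewrite measure0 mulr0 mul0r.
rewrite PX /= /poisson_pmf x0 mul1r mulrCA -expRD subrr expR0 mulr1.
by [].
Qed.


(** The series of cos and sin are the differences of the exponential series
    restricted to opposite residue classes modulo 4. *)
Lemma residues_cos_sin (X : Omega -> nat) (x : R)
  (p := fun j => fine (P [set w | X w %% 4 = j]%N)) :
  0 < x ->
  (forall k, measurable [set w | X w = k]) ->
  (forall k, P [set w | X w = k] = (poisson_pmf x k)%:E) ->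
  p 0%N - p 2%N = expR (- x) * cos x /\ p 1%N - p 3%N = expR (- x) * sin x.
Proof.
move=> x0 mX PX.
have cprob j := @cvg_prob_of_pmf X x [set k | k %% 4 = j]%N x0 mX PX.
have key (i j : nat) (u : R^nat) (l : R) : series u @ \oo --> l ->
    (forall k, u k = (k \in [set k | k %% 4 = i]%N)%:R * (x ^+ k * k`!%:R^-1) -
       (k \in [set k | k %% 4 = j]%N)%:R * (x ^+ k * k`!%:R^-1)) ->
    p i - p j = expR (- x) * l.
  move=> ul uE.
  have : series u @ \oo --> expR x * p i - expR x * p j.
    rewrite (_ : series u = fun n =>
      \sum_(0 <= k < n) ((k \in [set k | k %% 4 = i]%N)%:R * (x ^+ k * k`!%:R^-1))
    - \sum_(0 <= k < n) ((k \in [set k | k %% 4 = j]%N)%:R * (x ^+ k * k`!%:R^-1))).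
      exact: cvgB (cprob i) (cprob j).
    by apply/funext => n; rewrite -sumrB; apply: eq_bigr => k _; exact: uE.
  move=> /(cvg_unique (@Rhausdorff R) ul) ->.
  by rewrite -mulrBr mulrA -expRD addNr expR0 mul1r.
have modE (k j : nat) : (k \in [set k | k %% 4 = j]%N) = (k %% 4 == j)%N.
  by apply/idP/eqP => [/set_mem|/mem_set].
have phE (k : nat) : [/\ (~~ odd k)%:R * (-1) ^+ k./2 =
      (k %% 4 == 0)%N%:R - (k %% 4 == 2)%N%:R :> R
    & (odd k)%:R * (-1) ^+ k.-1./2 =
      (k %% 4 == 1)%N%:R - (k %% 4 == 3)%N%:R :> R].
  rewrite (divn_eq k 4) modnMDl modn_mod.
  set q := (k %/ 4)%N.
  have : (k %% 4 < 4)%N by rewrite ltn_mod.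
  rewrite (_ : (q * 4 = q.*2.*2)%N); last by rewrite -!muln2 -mulnA.
  have sq : (-1) ^+ q.*2 = 1 :> R by rewrite -mul2n exprM sqrrN expr1n expr1n.
  case: (k %% 4)%N => [|[|[|[|]]]]//= _; rewrite ?addn0 ?addnS ?addn0 /=
    ?odd_double /= ?doubleK ?mul0r ?mul1r ?subrr ?subr0 ?sub0r ?sq //; split=> //.
  - by rewrite exprS sq mulr1.
  - by rewrite exprS sq mulr1.
split.
- apply: (key 0%N 2%N (cos_coeff x)).
    by rewrite unlock; exact: is_cvg_series_cos_coeff.
  move=> k; rewrite !modE -mulrBl; have [<- _] := phE k.
  by rewrite /cos_coeff /= !mulrA.
- apply: (key 1%N 3%N (sin_coeff x)).
    by rewrite unlock; exact: is_cvg_series_sin_coeff.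
  move=> k; rewrite !modE -mulrBl; have [_ <-] := phE k.
  by rewrite /sin_coeff /= !mulrA.
Qed.

End Residues.

(** * The expectation over a Poisson path on a grid is a walk *)

(** A discrete variable may be frozen when checking measurability: its level
    sets cut the space into countably many measurable pieces. *)
Lemma measurable_fun_glue d (Omega : measurableType d) d' (T : measurableType d')
    (X : Omega -> nat) (G : nat -> Omega -> T) :
  measurable_fun setT X -> (forall k, measurable_fun setT (G k)) ->
  measurable_fun setT (fun w => G (X w) w).
Proof.
move=> mX mG _ B mB; rewrite setTI.
rewrite (_ : _ @^-1` B = \bigcup_k (X @^-1` [set k] `&` G k @^-1` B)).
  apply: bigcupT_measurable => k; apply: measurableI.
    by rewrite -[_ @^-1` _]setTI; exact: mX.
  by rewrite -[_ @^-1` _]setTI; exact: mG.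
apply/seteqP; split=> w /=; first by move=> BG; exists (X w).
by case=> k _ [<-].
Qed.

Lemma measurable_of_nat d (Omega : measurableType d) d' (T : measurableType d')
    (X : Omega -> nat) (G : nat -> T) :
  measurable_fun setT X -> measurable_fun setT (fun w => G (X w)).
Proof. by move=> mX; apply: (measurable_fun_glue (G := fun k _ => G k)). Qed.

Lemma integrable_bounded {R : realType} d (T : measurableType d)
    (mu : {measure set T -> \bar R}) (D : set T) (f : T -> R) (M : R) :
  measurable D -> (mu D < +oo)%E -> measurable_fun D f ->
  (forall x, D x -> `|f x| <= M) -> mu.-integrable D (EFin \o f).
Proof.
move=> mD muD mf fM; apply: measurable_bounded_integrable => //.
exists M; split; first exact: num_real.
by move=> M' MM' x Dx /=; rewrite (le_trans (fM _ Dx))// ltW.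
Qed.

Section Poisson.
Context {R : realType} d {Omega : measurableType d} {P : probability Omega R}.
Context {lambda : R} {N : R -> {RV P >-> nat}}.
Hypotheses (lambda0 : 0 < lambda) (HN : poisson_process lambda N).

Lemma measurable_count t : measurable_fun setT (N t : Omega -> nat).
Proof. exact: measurable_funPT. Qed.

Lemma count_le w s t : 0 <= s -> s <= t -> (N s w <= N t w)%N.
Proof. exact: poisson_nondecreasing HN w s t. Qed.

Variables (h : R) (h0 : 0 < h).
Implicit Types (y M : R) (b : bool) (w : Omega).

Definition increment i w := (N (i.+1%:R * h) w - N (i%:R * h) w)%N.

Lemma measurable_increment i : measurable_fun setT (increment i).
Proof.
apply: (measurable_fun_glue (G := fun k w => (k - N (i%:R * h) w)%N)).
  exact: measurable_count.
by move=> k; apply: measurable_of_nat; exact: measurable_count.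
Qed.

Lemma sum_increment w k : (\sum_(i < k) increment i w)%N = N (k%:R * h) w.
Proof.
elim: k => [|k IH].
  by rewrite big_ord0 mul0r (poisson_start HN).
rewrite big_ord_recr /= IH /increment subnKC// count_le//.
  by rewrite mulr_ge0// ltW.
by rewrite ler_wpM2r ?ler_nat// ltW.
Qed.

Lemma measurable_increment_set i (B : set nat) :
  measurable [set w | B (increment i w)].
Proof. by have := @measurable_increment i measurableT B; rewrite setTI; apply. Qed.

Lemma increment_pmf i k :
  P [set w | increment i w = k] = (poisson_pmf (lambda * h) k)%:E.
Proof.
have -> : lambda * h = lambda * (i.+1%:R * h - i%:R * h).
  by rewrite -mulrBl -natrB// subSnn mul1r.
apply: (poisson_increment HN); first by rewrite mulr_ge0// ltW.
by rewrite ltr_pM2r// ltr_nat.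
Qed.

Definition cylinder (A : nat -> set nat) m : set Omega :=
  \bigcap_(i < m) [set w | A i (increment i w)].

Lemma measurable_cylinder A m : measurable (cylinder A m).
Proof.
by apply: bigcap_measurableType => i _; exact: measurable_increment_set.
Qed.

Lemma cylinder_prob A m :
  P (cylinder A m) = (\prod_(i < m) P [set w | A i (increment i w)])%E.
Proof.
have := @poisson_independent_increments _ _ _ _ _ _ HN m (fun i => i%:R * h).
apply; first by rewrite mul0r.
by move=> i j ij; rewrite ler_wpM2r ?ler_nat// ltW.
Qed.

Lemma cylinderS_prob A m :
  P (cylinder A m.+1) = (P (cylinder A m) * P [set w | A m (increment m w)])%E.
Proof. by rewrite !cylinder_prob big_ord_recr. Qed.

Lemma cylinderS A m : cylinder A m.+1 = cylinder A m `&` [set w | A m (increment m w)].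
Proof.
apply/seteqP; split=> w.
  by move=> H; split=> [i /= im|]; apply: H => //=; exact: ltnW.
move=> [H1 H2] i /=; rewrite ltnS leq_eqVlt => /orP[/eqP->//|]; exact: H1.
Qed.

Variable e : bool.

Lemma measurable_path_value n m g y b :
  measurable_fun setT
    (fun w => path_value e h n (fun i => increment (m + i)%N w) g y b).
Proof.
elim: n m y b => [|n IH] m y b; first exact: measurable_cst.
rewrite /= addn0.
apply: (measurable_fun_glue
  (G := fun k w => phase e b k * path_value e h n (fun i => increment (m + i.+1) w) g
         (y - sg (b (+) odd k) * h) (b (+) odd k))).
  exact: measurable_increment.
move=> k; apply: measurable_funM => //.
apply: eq_measurable_fun (IH m.+1 (y - sg (b (+) odd k) * h) (b (+) odd k)).
move=> w _; apply: path_value_eq => i _; by rewrite addSnnS.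
Qed.

Lemma path_value_bounded (g : R -> bool -> R) M :
  (forall y b, `|g y b| <= M) ->
  forall n X y b, `|path_value e h n X g y b| <= M.
Proof.
by move=> gM; elim=> [//|n IH] X y b /=; rewrite normrM phase_norm mul1r.
Qed.

(** Induction on the number of increments still to be averaged, the event fixing
    the earlier ones being arbitrary: splitting it by the residue modulo 4 of
    the next increment gives four events of the same kind, whose probabilities
    factor by independence. *)
Lemma expectation_path_value g M : (forall y b, `|g y b| <= M) ->
  forall n m A y b,
  \int[P]_(w in cylinder A m) path_value e h n (fun i => increment (m + i)%N w) g y b =
  fine (P (cylinder A m)) * (expR (- (lambda * h)) ^+ n *
                        walk e h (lambda * h) n g y b).
Proof.
move=> gM; elim=> [|n IH] m A y b.
  by rewrite /= Rintegral_cst ?expr0 ?mul1r 1?mulrC//; exact: measurable_cylinder.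
(* The conditioning event extended by the residue of the next increment. *)
pose A' (j : nat) i := if (i < m)%N then A i else [set k | (k %% 4)%N = j].
pose p j := fine (P [set w | (increment m w %% 4)%N = j]).
have cA' j : cylinder (A' j) m = cylinder A m.
  by apply/seteqP; split=> w H i /= im; have := H i im; rewrite /A' im.
have cA'S j : cylinder (A' j) m.+1 = cylinder A m `&` [set w | (increment m w %% 4)%N = j].
  by rewrite cylinderS cA' /A' ltnn.
have PA'S j : fine (P (cylinder (A' j) m.+1)) = fine (P (cylinder A m)) * p j.
  rewrite cylinderS_prob cA' fineM ?fin_num_measure//; last 2 first.
  - exact: measurable_cylinder.
  - exact: measurable_increment_set.
  by rewrite /A' ltnn.
have DE : cylinder A m = \big[setU/set0]_(j <- iota 0 4) cylinder (A' j) m.+1.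
  rewrite -bigcup_seq; apply/seteqP; split=> w /=.
    move=> Dw; exists (increment m w %% 4)%N => /=.
      have : (increment m w %% 4 < 4)%N by rewrite ltn_mod.
      by case: (_ %% 4)%N => [|[|[|[|]]]].
    by rewrite cA'S.
  by case=> j _; rewrite cA'S => -[].
have tA' : trivIset [set` iota 0 4] (fun j => cylinder (A' j) m.+1).
  by move=> i j _ _ [w []]; rewrite !cA'S => -[_ /= <-] [_ /= <-].
have mps := @measurable_path_value n.+1 m g y b.
rewrite [in LHS]/Rintegral [in LHS]DE integral_bigsetU_EFin//; last 2 first.
- by move=> j; exact: measurable_cylinder.
- by apply/measurable_EFinP; apply: measurable_funTS.
rewrite -sum_fine; last first.
  move=> j _; apply: integrable_fin_num; first exact: measurable_cylinder.
  apply: (integrable_bounded (M := M)); first exact: measurable_cylinder.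
  - by rewrite ltey_eq fin_num_measure//; exact: measurable_cylinder.
  - exact: measurable_funTS.
  - by move=> w _; exact: path_value_bounded.
have step j : (j < 4)%N ->
   fine (\int[P]_(w in cylinder (A' j) m.+1)
    (path_value e h n.+1 (fun i => increment (m + i)%N w) g y b)%:E) =
   fine (P (cylinder A m)) * p j * (phase e b j * (expR (- (lambda * h)) ^+ n *
     walk e h (lambda * h) n g (y - sg (b (+) odd j) * h) (b (+) odd j))).
  move=> j4; rewrite -PA'S mulrCA -IH -RintegralZl//; last 2 first.
  - exact: measurable_cylinder.
  - apply: (integrable_bounded (M := M)); first exact: measurable_cylinder.
    + by rewrite ltey_eq fin_num_measure//; exact: measurable_cylinder.
    + by apply: measurable_funTS; exact: measurable_path_value.
    + by move=> w _; exact: path_value_bounded.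
  apply: eq_Rintegral => w /set_mem; rewrite cA'S => -[_ /= wj].
  rewrite addn0 phase_mod4 -(@odd_mod _ 4)// wj; congr (_ * _).
  by apply: path_value_eq => i _; rewrite addnS.
rewrite !big_cons big_nil !step//= addr0 !(addbT, addbF).
have a0 : 0 < lambda * h by rewrite mulr_gt0.
have [] := @residues_cos_sin _ _ _ P (increment m) (lambda * h) a0.
- by move=> k; exact: (measurable_increment_set m [set k]).
- by move=> k; exact: increment_pmf.
rewrite -/(p 0%N) -/(p 1%N) -/(p 2%N) -/(p 3%N) => p02 p13.
rewrite sgN !negbK !turnN !mulr1 !mulNr !opprK !mulrN turn2 mulr1.
rewrite exprS.
set E := expR _; set w0 := walk _ _ _ _ _ (_ - _) _; set w1 := walk _ _ _ _ _ (_ + _) _.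
transitivity (fine (P (cylinder A m)) * E ^+ n *
   ((p 0%N - p 2%N) * w0 + turn e b * (p 1%N - p 3%N) * w1)); first by ring.
by rewrite p02 p13 -/E; ring.
Qed.

Lemma expectation_walk g M n y b : (forall y b, `|g y b| <= M) ->
  expR (lambda * (n%:R * h)) * \int[P]_w
   (phase e b (N (n%:R * h) w) *
    g (y - sg b * (h * \sum_(k < n) (-1) ^+ N (k.+1%:R * h) w))
      (b (+) odd (N (n%:R * h) w))) =
  walk e h (lambda * h) n g y b.
Proof.
move=> gM.
have := @expectation_path_value g M gM n 0%N (fun=> setT) y b.
have -> : cylinder (fun=> setT) 0 = setT by apply/seteqP; split.
rewrite probability_setT /= mul1r => E.
rewrite (_ : Rintegral _ _ _ =
    \int[P]_w path_value e h n (fun i => increment (0 + i)%N w) g y b).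
  rewrite E mulrA -expRM_natl -expRD.
  rewrite (_ : _ + _ = 0) ?expR0 ?mul1r//.
  by ring.
apply: eq_Rintegral => w _; rewrite path_valueE /= sum_increment.
by under [in RHS]eq_bigr => k _ do rewrite sum_increment.
Qed.

End Poisson.

(** * Paths and their displacement *)

Lemma normr_Rintegral_le {R : realType} d (T : measurableType d)
    (mu : {measure set T -> \bar R}) (D : set T) (f : T -> R) (M : R) :
  measurable D -> (mu D < +oo)%E -> measurable_fun D f ->
  (forall x, D x -> `|f x| <= M) ->
  `|\int[mu]_(x in D) f x| <= M * fine (mu D).
Proof.
move=> mD muD mf fM; have intf := integrable_bounded mD muD mf fM.
rewrite (le_trans (le_normr_Rintegral _ _))// -Rintegral_cst//.
apply: le_Rintegral => //; first exact: integrable_norm.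
apply: (@integrable_bounded _ _ _ _ _ _ `|M|) => //.
Qed.

Lemma lebesgue_itv_lty {R : realType} (b1 b2 : bool) (x y : R) :
  (lebesgue_measure [set` Interval (BSide b1 x) (BSide b2 y)] < +oo)%E.
Proof.
by rewrite lebesgue_measure_itv /=; case: ifP => _; rewrite ?ltry// -EFinB ltry.
Qed.

Lemma lebesgue_itv_fine {R : realType} (b1 b2 : bool) (x y : R) : x <= y ->
  fine (lebesgue_measure [set` Interval (BSide b1 x) (BSide b2 y)]) = y - x.
Proof.
move=> xy; rewrite lebesgue_measure_itv /= lte_fin; case: ltP => //= yx.
by apply/esym/eqP; rewrite subr_eq0 eq_le xy yx.
Qed.

Lemma measurable_nondecreasing_nat {R : realType} (f : R -> nat) :
  {homo f : x y / x <= y >-> (x <= y)%N} -> measurable_fun setT f.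
Proof.
move=> f_nd; pose F (s : R) : R := (f s)%:R.
have mF : measurable_fun setT F.
  by apply: nondecreasing_measurable => // x y xy; rewrite /F ler_nat f_nd.
move=> _ B _; rewrite setTI.
rewrite (_ : _ @^-1` B = \bigcup_(k in B) (F @^-1` [set k%:R])).
  apply: bigcup_measurable => k _; rewrite -[_ @^-1` _]setTI.
  exact: mF.
apply/seteqP; split=> s /=; first by move=> Bs; exists (f s).
by case=> k Bk /eqP; rewrite /F eqr_nat => /eqP ->.
Qed.

Lemma cvg_of_dist_le {R : realType} {I : Type} (F : set_system I) {FF : Filter F}
    (u : I -> R) (l : R) (r : I -> R) :
  r @ F --> 0 -> (\forall i \near F, `|u i - l| <= r i) -> u @ F --> l.
Proof.
move=> r0 ul; apply/cvgrPdist_lt => eps eps0.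
have rlt : \forall i \near F, r i < eps by apply: cvgr_lt r0 _ _.
near=> i; rewrite distrC (@le_lt_trans _ _ (r i))//; near: i; exact.
Unshelve. all: by end_near. Qed.

Lemma mesh_mul {R : realType} (t : R) n : n.+1%:R * (t / n.+1%:R) = t.
Proof. by rewrite mulrC divfK// pnatr_eq0. Qed.

Lemma cvg_mesh {R : realType} (t : R) : t / n.+1%:R @[n --> \oo] --> (0 : R).
Proof.
rewrite -[X in _ --> X](mulr0 t); apply: cvgM; first exact: cvg_cst.
exact: cvg_harmonic.
Qed.

Section Path.
Context {R : realType} d {Omega : measurableType d} {P : probability Omega R}.
Context {lambda : R} {N : R -> {RV P >-> nat}}.
Hypotheses (lambda0 : 0 < lambda) (HN : poisson_process lambda N).

Lemma measurable_path w (D : set R) : measurable D -> D `<=` `[0, +oo[ ->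
  measurable_fun D (fun s => (-1) ^+ N s w : R).
Proof.
move=> mD D0.
have mNat : measurable_fun setT (fun s : R => N (Num.max 0 s) w).
  apply: measurable_nondecreasing_nat => x y xy; apply: (count_le HN).
    by rewrite le_max lexx.
  by rewrite ge_max !le_max lexx /= xy orbT.
have : measurable_fun D (fun s : R => (-1) ^+ N (Num.max 0 s) w : R).
  by apply: measurable_funTS; exact: (measurable_of_nat _ mNat).
apply: eq_measurable_fun => s /set_mem /D0 /=.
by rewrite in_itv /= andbT => s0; rewrite max_r.
Qed.

Lemma path_sign_norm s w : `|(-1) ^+ N s w : R| <= 1.
Proof. by rewrite normrX normrN1 expr1n. Qed.

Lemma integrable_path w (b1 b2 : bool) (x y : R) : 0 <= x ->
  (@lebesgue_measure R).-integrable [set` Interval (BSide b1 x) (BSide b2 y)]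
    (EFin \o (fun s => (-1) ^+ N s w : R)).
Proof.
move=> x0; apply: (integrable_bounded (M := 1)) => //.
- exact: lebesgue_itv_lty.
- apply: measurable_path => // s; rewrite /= !in_itv /= => /andP[+ _].
  by case: b1 => /= [|/ltW] xs; rewrite (le_trans x0 xs).
- by move=> s _; exact: path_sign_norm.
Qed.

Definition displacement (t : R) (w : Omega) : R :=
  \int[lebesgue_measure]_(s in `[0, t]) ((-1) ^+ N s w : R).

Lemma displacement0 w : displacement 0 w = 0.
Proof. by rewrite /displacement set_itv1 Rintegral_set1. Qed.

Lemma displacementB w s t : 0 <= s -> s <= t ->
  displacement t w - displacement s w = \int[lebesgue_measure]_(r in `]s, t]) ((-1) ^+ N r w : R).
Proof.
move=> s0 st; rewrite /displacement Rintegral_itvB//.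
by exact: integrable_path.
Qed.

Lemma displacementB_le w s t : 0 <= s -> s <= t -> `|displacement t w - displacement s w| <= t - s.
Proof.
move=> s0 st; rewrite displacementB// -[leRHS]mul1r -(lebesgue_itv_fine false false st).
apply: normr_Rintegral_le => //.
- exact: lebesgue_itv_lty.
- apply: measurable_path => // r; rewrite /= !in_itv /= andbT => /andP[/ltW + _].
  exact: le_trans.
- by move=> r _; exact: path_sign_norm.
Qed.

Lemma displacement_le w t : 0 <= t -> `|displacement t w| <= t.
Proof. by move=> t0; have := @displacementB_le w 0 t; rewrite displacement0 !subr0; apply. Qed.

Definition grid_displacement (h : R) n w : R := h * \sum_(k < n) (-1) ^+ N (k.+1%:R * h) w.

(** On a cell without jump the integrand is constant and the Riemann sum is
    exact.  The other cells cost at most 2 h each, and there are at most as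
    many of them as jumps because the path is nondecreasing. *)
Lemma grid_displacement_dist_le h n w : 0 < h ->
  `|grid_displacement h n w - displacement (n%:R * h) w| <= 2 * h * (N (n%:R * h) w)%:R.
Proof.
move=> h0; elim: n => [|n IH].
  rewrite /grid_displacement big_ord0 mul0r displacement0 mulr0 subr0 normr0.
  by rewrite !mulr_ge0// ltW.
set t := n%:R * h in IH *; set t' := n.+1%:R * h.
have tt' : t' = t + h by rewrite /t' /t -natr1 mulrDl mul1r.
have t0 : 0 <= t by rewrite mulr_ge0// ltW.
have let' : t <= t' by rewrite tt' lerDl ltW.
have Nle := count_le HN w t0 let'.
have step : `|h * (-1) ^+ N t' w - (displacement t' w - displacement t w)| <=
    2 * h * (N t' w - N t w)%:R.
  have [E|NE] := eqVneq (N t w) (N t' w).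
    rewrite displacementB// E subnn mulr0.
    rewrite (@eq_Rintegral _ _ _ _ _ (fun=> (-1) ^+ N t' w)).
      rewrite Rintegral_cst// lebesgue_itv_fine//.
      by rewrite tt' [t + h]addrC addrK mulrC subrr normr0.
    move=> r /set_mem /=; rewrite in_itv /= => /andP[tr rt']; congr (_ ^+ _).
    apply/eqP; rewrite eqn_leq (count_le HN)//=; last exact: le_trans (ltW tr).
    by rewrite -E (count_le HN)// ltW.
  rewrite (le_trans (ler_normB _ _))// (@le_trans _ _ (h + h))//.
    apply: lerD.
      by rewrite normrM (gtr0_norm h0) ler_piMr ?(ltW h0)//; exact: path_sign_norm.
    by rewrite (le_trans (displacementB_le w t0 let'))// tt' [t + h]addrC addrK.
  rewrite (_ : h + h = 2 * h); last by ring.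
  rewrite ler_peMr//; first by rewrite mulr_ge0// ltW.
  by rewrite ler1n subn_gt0 ltn_neqAle NE.
have -> : grid_displacement h n.+1 w = grid_displacement h n w + h * (-1) ^+ N t' w.
  by rewrite /grid_displacement big_ord_recr /= mulrDr.
have -> : (N t' w)%:R = (N t w)%:R + (N t' w - N t w)%:R :> R.
  by rewrite -natrD subnKC.
rewrite mulrDr (le_trans _ (lerD IH step))//.
rewrite (le_trans _ (ler_normD _ _))//.
by rewrite le_eqVlt; apply/orP; left; apply/eqP; congr `|_|; ring.
Qed.

Lemma measurable_grid_displacement h n : measurable_fun setT (grid_displacement h n).
Proof.
apply: measurable_funM => //; apply: measurable_sum => k.
by apply: measurable_of_nat; exact: measurable_count.
Qed.

(** The grid may end slightly after t, which adds at most the length of the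
    overshoot. *)
Lemma cvg_grid_displacement w (h : nat -> R) (k : nat -> nat) (t : R) :
  0 <= t -> (forall n, 0 < h n) -> h n @[n --> \oo] --> 0 ->
  (forall n, t <= (k n)%:R * h n) -> (k n)%:R * h n @[n --> \oo] --> t ->
  grid_displacement (h n) (k n) w @[n --> \oo] --> displacement t w.
Proof.
move=> t0 h0 hc tk kc.
have kc1 : \forall n \near \oo, (k n)%:R * h n <= t + 1.
  by apply: cvgr_le kc _ _; rewrite ltrDl.
have bnd : \forall n \near \oo, `|grid_displacement (h n) (k n) w - displacement t w| <=
   2 * h n * (N (t + 1) w)%:R + ((k n)%:R * h n - t).
  near=> n.
  have kn1 : (k n)%:R * h n <= t + 1 by near: n.
  rewrite (_ : grid_displacement _ _ _ - _ =
    (grid_displacement (h n) (k n) w - displacement ((k n)%:R * h n) w) +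
    (displacement ((k n)%:R * h n) w - displacement t w)); last by ring.
  rewrite (le_trans (ler_normD _ _))//; apply: lerD; last exact: displacementB_le.
  rewrite (le_trans (grid_displacement_dist_le _ _ _))//.
  apply: ler_wpM2l; first by rewrite mulr_ge0// ltW.
  by rewrite ler_nat (count_le HN)// (le_trans t0).
apply: cvg_of_dist_le bnd.
rewrite -[X in _ --> X](_ : 2 * 0 * (N (t + 1) w)%:R + (t - t) = 0); last by ring.
apply: cvgD; last by apply: cvgB => //; exact: cvg_cst.
by apply: cvgMl; apply: cvgMr.
Unshelve. all: by end_near. Qed.

End Path.

(** * Convergence of the walks *)

Lemma bounded_convergence {R : realType} d (T : measurableType d)
    (mu : {measure set T -> \bar R}) (D : set T) (f_ : nat -> T -> R)
    (f : T -> R) (M : R) :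
  measurable D -> (mu D < +oo)%E -> (forall n, measurable_fun D (f_ n)) ->
  (forall n x, D x -> `|f_ n x| <= M) ->
  (forall x, D x -> f_ n x @[n --> \oo] --> f x) ->
  measurable_fun D f /\
  \int[mu]_(x in D) f_ n x @[n --> \oo] --> \int[mu]_(x in D) f x.
Proof.
move=> mD muD mf_ fM ff.
have mf : measurable_fun D f by exact: measurable_fun_cvg ff.
split=> //.
have M0 x : D x -> 0 <= M by move=> /(fM 0%N); exact: le_trans.
have [] := @dominated_convergence _ _ _ mu D mD (fun n => EFin \o f_ n)
  (EFin \o f) (EFin \o cst M).
- by move=> n; exact/measurable_EFinP.
- exact/measurable_EFinP.
- by apply: aeW => x Dx; apply: cvg_EFin; [exact: nearW|exact: ff].
- apply: (integrable_bounded (M := `|M|)) => //.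
- by apply: aeW => x n Dx /=; rewrite lee_fin fM.
move=> intf _ c; apply: fine_cvg; rewrite fineK; first exact: c.
exact: integrable_fin_num.
Qed.

Lemma cvg_slice {R : realType} {I : Type} (F : set_system I) {FF : Filter F}
    (g : R -> bool -> R) b (u : I -> R) (l : R) : continuous (g ^~ b) ->
  u @ F --> l -> (fun i => g (u i) b) @ F --> g l b.
Proof. move=> cg ul. exact (@continuous_cvg _ R R F FF u (g ^~ b) l (cg l) ul). Qed.

Section Real_psi.
Context {R : realType} d {Omega : measurableType d} {P : probability Omega R}.
Context {lambda : R} {N : R -> {RV P >-> nat}}.
Hypotheses (lambda0 : 0 < lambda) (HN : poisson_process lambda N).
Variable e : bool.
Implicit Types (g : R -> bool -> R) (t h y M : R).

Lemma measurable_displacement t : 0 <= t ->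
  measurable_fun setT (displacement (N := N) t).
Proof.
rewrite le_eqVlt => /predU1P[<-|t0].
  rewrite (_ : displacement 0 = cst 0); first exact: measurable_cst.
  by apply/funext => w; rewrite displacement0.
apply: (measurable_fun_cvg (h := fun n => grid_displacement (N := N) (t / n.+1%:R) n.+1)).
- by move=> n; exact: measurable_grid_displacement.
- move=> w _.
  move: (@cvg_grid_displacement _ _ _ _ _ _ HN w (fun n => t / n.+1%:R) (fun n => n.+1) t).
  apply.
  + exact: ltW.
  + by move=> n; rewrite divr_gt0.
  + exact: cvg_mesh.
  + by move=> n; rewrite mesh_mul.
  + by under eq_fun do rewrite mesh_mul; exact: cvg_cst.
Qed.

Definition flow (g : R -> bool -> R) (t y : R) (b : bool) (w : Omega) : R :=
  phase e b (N t w) * g (y - sg b * displacement (N := N) t w) (b (+) odd (N t w)).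

(** The real form of [psi]; [psi_cpart_data] relates the two. *)
Definition real_psi (g : R -> bool -> R) (t y : R) (b : bool) : R :=
  expR (lambda * t) * \int[P]_w flow g t y b w.

Lemma measurable_flow g t y b : 0 <= t -> (forall b, continuous (g ^~ b)) ->
  measurable_fun setT (flow g t y b).
Proof.
move=> t0 cg.
apply: (measurable_fun_glue (G := fun k w =>
  phase e b k * g (y - sg b * displacement (N := N) t w) (b (+) odd k))).
  exact: measurable_count.
move=> k; apply: measurable_funM => //.
apply: (measurableT_comp (f := g ^~ (b (+) odd k))).
  exact: continuous_measurable_fun.
apply: measurable_funB => //; apply: measurable_funM => //.
exact: measurable_displacement.
Qed.

(** Right continuity of an integer-valued path; this is why times are
    approximated from the right. *)
Lemma count_right_constant w (t : R) (tau : nat -> R) : 0 <= t ->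
  (forall n, t <= tau n) -> tau n @[n --> \oo] --> t ->
  \forall n \near \oo, N (tau n) w = N t w.
Proof.
move=> t0 ttau tauc.
have : \forall s \near t^'+, N s w = N t w.
  exact: (poisson_right_continuous HN (w := w) t0 (discrete_set1 _)).
case=> r /= r0 rN.
have : \forall n \near \oo, `|t - tau n| < r by move/cvgrPdist_lt : tauc; exact.
apply: filterS => n trn; have := ttau n; rewrite le_eqVlt => /predU1P[<-//|].
exact: rN.
Qed.

Lemma measurable_discrete_flow g t h n y b : (forall b, continuous (g ^~ b)) ->
  measurable_fun setT (fun w => phase e b (N t w) *
    g (y - sg b * grid_displacement (N := N) h n w) (b (+) odd (N t w))).
Proof.
move=> cg; apply: (measurable_fun_glue (G := fun j w =>
    phase e b j * g (y - sg b * grid_displacement (N := N) h n w) (b (+) odd j))).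
  exact: measurable_count.
move=> j; apply: measurable_funM => //.
apply: (measurableT_comp (f := g ^~ (b (+) odd j))).
  exact: continuous_measurable_fun.
apply: measurable_funB => //; apply: measurable_funM => //.
exact: measurable_grid_displacement.
Qed.

(** The times are allowed to approximate t from the right and the positions to
    move, as needed for the walk sampled along a characteristic.  Under the
    expectation the convergence is pointwise and bounded. *)
Lemma walk_cvg g M (h : nat -> R) (k : nat -> nat) (t : R) (yn : nat -> R) y b :
  (forall b, continuous (g ^~ b)) -> (forall y b, `|g y b| <= M) ->
  0 <= t -> (forall n, 0 < h n) -> h n @[n --> \oo] --> 0 ->
  (forall n, t <= (k n)%:R * h n) -> (k n)%:R * h n @[n --> \oo] --> t ->
  yn n @[n --> \oo] --> y ->
  walk e (h n) (lambda * h n) (k n) g (yn n) b @[n --> \oo] --> real_psi g t y b.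
Proof.
move=> cg gM t0 h0 hc tk kc ync.
under eq_fun do rewrite -(expectation_walk lambda0 HN (h0 _) e _ _ _ gM).
apply: cvgM.
  apply: continuous_cvg; first exact: continuous_expR.
  by apply: cvgM => //; exact: cvg_cst.
apply: (proj2 (@bounded_convergence _ _ _ P setT _ _ M _ _ _ _ _)) => //.
- by rewrite ltey_eq fin_num_measure.
- by move=> n; exact: measurable_discrete_flow.
- by move=> n w _; rewrite normrM phase_norm mul1r.
- move=> w _; rewrite /flow.
  have Nt := count_right_constant w t0 tk kc.
  apply: (@cvg_trans _ ((fun n => phase e b (N t w) *
      g (yn n - sg b * grid_displacement (N := N) (h n) (k n) w) (b (+) odd (N t w))) @ \oo)).
    apply: near_eq_cvg; near=> n.
    by rewrite (_ : N ((k n)%:R * h n) w = N t w)//; near: n.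
  apply: cvgM; first exact: cvg_cst.

  apply: (cvg_slice (cg _)).
  apply: cvgB => //; apply: cvgM; first exact: cvg_cst.
  exact: (cvg_grid_displacement HN).
Unshelve. all: by end_near. Qed.

Lemma normr_expectation_le (F : Omega -> R) M : measurable_fun setT F ->
  (forall w, `|F w| <= M) -> `|\int[P]_w F w| <= M.
Proof.
move=> mF FM.
rewrite -[leRHS]mulr1 -(_ : fine (P setT) = 1); last by rewrite probability_setT.
apply: normr_Rintegral_le => //.
by rewrite ltey_eq fin_num_measure.
Qed.

Lemma walk_bounded g M h n y b : 0 < h -> (forall b, continuous (g ^~ b)) ->
  (forall y b, `|g y b| <= M) ->
  `|walk e h (lambda * h) n g y b| <= expR (lambda * (n%:R * h)) * M.
Proof.
move=> h0 cg gM; rewrite -(expectation_walk lambda0 HN h0 e _ _ _ gM).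
rewrite normrM gtr0_norm ?expR_gt0// ler_wpM2l ?expR_ge0//.
apply: normr_expectation_le => [|w]; last by rewrite normrM phase_norm mul1r.
exact: measurable_discrete_flow.
Qed.

Lemma real_psi_bounded g M t y b : 0 <= t -> (forall b, continuous (g ^~ b)) ->
  (forall y b, `|g y b| <= M) ->
  `|real_psi g t y b| <= expR (lambda * t) * M.
Proof.
move=> t0 cg gM; rewrite /real_psi.
rewrite normrM gtr0_norm ?expR_gt0// ler_wpM2l ?expR_ge0//.
apply: normr_expectation_le => [|w]; first exact: measurable_flow.
by rewrite normrM phase_norm mul1r.
Qed.

Lemma real_psi0 g y b : real_psi g 0 y b = g y b.
Proof.
rewrite /real_psi mulr0 expR0 mul1r.
rewrite (@eq_Rintegral _ _ _ _ _ (fun=> g y b)).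
  rewrite Rintegral_cst// -[RHS]mulr1; congr (_ * _).
  exact: (congr1 fine (probability_setT P)).
by move=> w _; rewrite /flow (poisson_start HN) displacement0 mulr0 subr0 addbF mul1r.
Qed.

(** Dominated convergence: at fixed t, the position enters only through g. *)
Lemma real_psi_continuous_space g M t b : 0 <= t -> (forall b, continuous (g ^~ b)) ->
  (forall y b, `|g y b| <= M) ->
  continuous (real_psi g t ^~ b).
Proof.
move=> t0 cg gM y; apply/(@cvg_nbhsP _ R^o) => u uy.
apply: cvgM; first exact: cvg_cst.
apply: (proj2 (@bounded_convergence _ _ _ P setT _ _ M _ _ _ _ _)) => //.
- by rewrite ltey_eq fin_num_measure.
- by move=> n; exact: measurable_flow.
- by move=> n w _; rewrite normrM phase_norm mul1r.
- move=> w _; apply: cvgM; first exact: cvg_cst.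
  apply: (cvg_slice (cg _)).
  by apply: cvgB => //; exact: cvg_cst.
Qed.

End Real_psi.

(** * Duhamel formula along characteristics *)

Lemma Rintegral_step {R : realType} (F : nat -> R) (h : R) n : 0 < h ->
  \int[lebesgue_measure]_(r in `[0, n%:R * h[) F (Num.truncn (r / h)) =
  h * \sum_(k < n) F k.
Proof.
move=> h0.
have mF : measurable_fun setT (fun r : R => F (Num.truncn (r / h))).
  apply: measurable_of_nat; apply: measurable_nondecreasing_nat => x y xy.
  by apply: le_truncn; rewrite ler_pM2r ?invr_gt0.
elim: n => [|n IH].
  by rewrite mul0r set_itvco0 Rintegral_set0 big_ord0 mulr0.
have nn1 : n%:R * h <= n.+1%:R * h by rewrite ler_pM2r// ler_nat.
rewrite (@itv_bndbnd_setU _ _ _ (BLeft (n%:R * h)));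
  [|by rewrite bnd_simp mulr_ge0// ltW|by rewrite bnd_simp].
rewrite Rintegral_setU//=; last 2 first.
- apply: (integrable_bounded (M := \sum_(k < n.+1) `|F k|)).
  + by apply: measurableU.
  + rewrite -itv_bndbnd_setU; first exact: lebesgue_itv_lty.
      by rewrite bnd_simp mulr_ge0// ltW.
    by rewrite bnd_simp.
  + exact: measurable_funTS.
  + move=> r; rewrite -itv_bndbnd_setU; last 2 first.
      by rewrite bnd_simp mulr_ge0// ltW.
      by rewrite bnd_simp.
    rewrite /= in_itv /= => /andP[r0 rn].
    have kn : (Num.truncn (r / h) < n.+1)%N.
      by rewrite ltnS truncn_le_nat ltr_pdivrMr.
    by rewrite (bigD1 (Ordinal kn))//= lerDl sumr_ge0.
- apply/disj_setPS => r [/=]; rewrite !in_itv /= => /andP[_ rn] /andP[nr _].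
  by move: rn; rewrite ltNge nr.
rewrite IH big_ord_recr /= mulrDr; congr (_ + _).
rewrite (@eq_Rintegral _ _ _ _ _ (fun=> F n)).
  rewrite Rintegral_cst// lebesgue_itv_fine// mulrC; congr (_ * _).
  by rewrite -mulrBl -natrB// subSnn mul1r.
move=> r /set_mem /=; rewrite in_itv /= => /andP[nr rn].
congr F; apply: truncn_def.
by rewrite ler_pdivlMr// nr ltr_pdivrMr.
Qed.

Lemma is_derive_seq {R : realType} (f : R -> R) (l : R) (a : nat -> R) :
  is_derive (0 : R) (1 : R) f l -> (forall n, a n != 0) -> a n @[n --> \oo] --> 0 ->
  (f (a n) - f 0) / a n @[n --> \oo] --> l.
Proof.
move=> [/cvg_ex[/= l' fl'] fE] a_neq0 a0.
have ll' : l = l'.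
  by rewrite -fE; apply/cvg_lim => //; exact: Rhausdorff.
rewrite ll'; move/cvgr_dnbhsP : fl' => /(_ a (conj a_neq0 a0)).
apply: cvg_trans; apply: near_eq_cvg; apply: nearW => n /=.
by rewrite /GRing.scale /= mulr1 addr0 mulrC.
Qed.

Section Duhamel.
Context {R : realType} d {Omega : measurableType d} {P : probability Omega R}.
Context {lambda : R} {N : R -> {RV P >-> nat}}.
Hypotheses (lambda0 : 0 < lambda) (HN : poisson_process lambda N).
Variable e : bool.
Variables (g : R -> bool -> R) (M : R).
Hypotheses (cg : forall b, continuous (g ^~ b)) (gM : forall y b, `|g y b| <= M).

Local Notation v := (real_psi (lambda := lambda) (N := N) e g).

Lemma bound_ge0 : 0 <= M.
Proof. exact: le_trans (gM 0 false). Qed.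

(** Euler scheme for the Duhamel formula.  Along a characteristic, one step of
    the walk multiplies by cos a and adds sin a times the other chirality; the
    latter is traded for the value of the other chirality at the end of the
    step, for which the convergence to the process is known.  With a = lambda h
    each step then errs by o(a). *)
Lemma walk_defect (h x C : R) n b : 
  (forall k y b, (k <= n)%N -> `|walk e h (lambda * h) k g y b| <= C) ->
  `|walk e h (lambda * h) n g (x + sg b * (n%:R * h)) b - g x b -
    turn e b * (lambda * h * \sum_(k < n)
       walk e h (lambda * h) k.+1 g (x + sg b * (k.+1%:R * h)) (~~ b))| <=
  n%:R * (`|cos (lambda * h) - 1| +
     `|sin (lambda * h) - (lambda * h) * cos (lambda * h)| +
     `|(lambda * h) * sin (lambda * h)|) * C.
Proof.
set a := lambda * h.
move=> wC; elim: n wC => [|n IH] wC.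
  by rewrite big_ord0 /= !mul0r !mulr0 addr0 subrr subr0 normr0.
set E := `|cos a - 1| + _ + _ in IH *.
have {}IH := IH (fun k y b kn => wC k y b (leqW kn)).
pose W := walk e h a n g (x + sg b * (n%:R * h)) b.
(* The other chirality moves backwards, so it starts two cells ahead. *)
pose Z := walk e h a n g (x + sg b * (n.+2%:R * h)) (~~ b).
have E1 : walk e h a n.+1 g (x + sg b * (n.+1%:R * h)) b =
    cos a * W + turn e b * sin a * Z.
  rewrite /=; congr (_ * _ + _ * _); rewrite /W /Z; congr walk.
    by rewrite -(natr1 n); ring.
  by rewrite -(natr1 n.+1) -(natr1 n); ring.
have E2 : walk e h a n.+1 g (x + sg b * (n.+1%:R * h)) (~~ b) =
    cos a * Z - turn e b * sin a * W.
  rewrite /= negbK turnN sgN !mulNr opprK.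
  congr (_ * _ - _ * _); rewrite /W /Z; congr walk.
    by rewrite -(natr1 n.+1) -(natr1 n); ring.
  by rewrite -(natr1 n); ring.
rewrite big_ord_recr E1.
rewrite [X in _ * (_ * X)](_ : _ = \sum_(k < n)
      walk e h a k.+1 g (x + sg b * (k.+1%:R * h)) (~~ b) +
   (cos a * Z - turn e b * sin a * W)); last by rewrite -E2.
set S := \sum_(k < n) _ in IH *.
rewrite -/W in IH.
rewrite [X in `|X|](_ : _ = (W - g x b - turn e b * (a * S)) +
   ((cos a - 1) * W + turn e b * ((sin a - a * cos a) * Z)
     + turn e b * turn e b * (a * sin a * W))); last by ring.
rewrite turn2 mul1r (_ : n.+1%:R * E * C = n%:R * E * C + E * C); last first.
  by rewrite -(natr1 n); ring.
rewrite (le_trans (ler_normD _ _))//; apply: lerD => //.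
have WC : `|W| <= C by exact: wC.
have ZC : `|Z| <= C by exact: wC.
rewrite [leRHS](_ : _ = `|cos a - 1| * C + `|sin a - a * cos a| * C +
  `|a * sin a| * C); last by rewrite /E !mulrDl.
apply: le_trans (ler_normD _ _) _; apply: lerD;
  first (apply: le_trans (ler_normD _ _) _; apply: lerD).
- by rewrite normrM ler_wpM2l.
- by rewrite !normrM turn_norm mul1r ler_wpM2l.
- by rewrite normrM ler_wpM2l.
Qed.

(** Limit of [walk_defect] with n steps of length t / n: the Riemann sum is the
    integral of a step function, and the total error n o(a) vanishes because
    sin a / a tends to 1 and (cos a - 1) / a tends to 0. *)
Lemma duhamel_co t x b : 0 < t ->
  measurable_fun (`[0, t[ : set R) (fun r => v r (x + sg b * r) (~~ b)) /\
  v t (x + sg b * t) b = g x b + turn e b * (lambda *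
    \int[lebesgue_measure]_(r in `[0, t[) v r (x + sg b * r) (~~ b)).
Proof.
move=> t0.
pose h n : R := t / n.+1%:R.
have h0 n : 0 < h n by rewrite divr_gt0.
have hE n : n.+1%:R * h n = t by exact: mesh_mul.
have hc : h n @[n --> \oo] --> (0 : R) by exact: cvg_mesh.
pose C := expR (lambda * t) * M.
have wC n k y c : (k <= n.+1)%N -> `|walk e (h n) (lambda * h n) k g y c| <= C.
  move=> kn; rewrite (le_trans (walk_bounded lambda0 HN e k y c (h0 n) cg gM))//.
  rewrite /C ler_wpM2r ?bound_ge0// ler_expR ler_wpM2l// ?(ltW lambda0)//.
  by rewrite -(hE n) ler_wpM2r ?ler_nat// ltW.
(* End of the cell containing r: tau n r lies to the right of r, within h n. *)
pose k n (r : R) := (Num.truncn (r / h n)).+1.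
pose tau n r := (k n r)%:R * h n.
have k_lt n r : 0 <= r < t -> (k n r <= n.+1)%N.
  by move=> /andP[r0 rt]; rewrite /k ltnS truncn_le_nat ltr_pdivrMr// hE.
have tau_gt n r : r <= tau n r.
  by rewrite -ler_pdivrMr// ltW// truncnS_gt.
have tau_le n r : 0 <= r -> tau n r <= r + h n.
  move=> r0; rewrite /tau /k -natr1 mulrDl mul1r lerD2r -ler_pdivlMr//.
  by rewrite truncn_le divr_ge0// ltW.
have tau_c r : 0 <= r -> tau n r @[n --> \oo] --> r.
  move=> r0; apply: cvg_of_dist_le hc _; apply: nearW => n.
  by rewrite ger0_norm ?subr_ge0// lerBlDl tau_le.
pose S n j := walk e (h n) (lambda * h n) j.+1 g
  (x + sg b * (j.+1%:R * h n)) (~~ b).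
pose Y n r := walk e (h n) (lambda * h n) (k n r) g (x + sg b * tau n r) (~~ b).
have [mv cv] : measurable_fun (`[0, t[ : set R) (fun r => v r (x + sg b * r) (~~ b)) /\
   \int[lebesgue_measure]_(r in `[0, t[) Y n r @[n --> \oo] -->
   \int[lebesgue_measure]_(r in `[0, t[) v r (x + sg b * r) (~~ b).
  have := @bounded_convergence _ _ _ (@lebesgue_measure R) `[0, t[ Y
    (fun r => v r (x + sg b * r) (~~ b)) C.
  apply=> //.
  - exact: lebesgue_itv_lty.
  - move=> n; apply: measurable_funTS.
    apply: (measurable_of_nat (S n)).
    apply: measurable_nondecreasing_nat => r s rs.
    by apply: le_truncn; rewrite ler_pM2r ?invr_gt0.
  - by move=> n r /=; rewrite in_itv /= => rt; apply: wC; exact: k_lt.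
  - move=> r /=; rewrite in_itv /= => /andP[r0 rt].
    have := @walk_cvg _ _ _ _ _ _ lambda0 HN e g M h (k ^~ r) r
      (fun n => x + sg b * tau n r) (x + sg b * r) (~~ b) cg gM.
    apply=> //; [by move=> n; exact: tau_gt|exact: tau_c|].
    by apply: cvgD; [exact: cvg_cst|apply: cvgM; [exact: cvg_cst|exact: tau_c]].
split=> //.
have YE n : \int[lebesgue_measure]_(r in `[0, t[) Y n r =
    h n * \sum_(j < n.+1) S n j.
  by rewrite -(Rintegral_step (S n))// hE.
pose a n := lambda * h n.
have a0 n : 0 < a n by rewrite mulr_gt0.
have ac : a n @[n --> \oo] --> 0.
  by rewrite -[X in _ --> X](mulr0 lambda); apply: cvgM; [exact: cvg_cst|].
have an n : a n != 0 by rewrite gt_eqF.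
have sin_c := is_derive_seq (is_derive_sin 0) an ac.
have cos_c := is_derive_seq (is_derive_cos 0) an ac.
pose D n := walk e (h n) (a n) n.+1 g (x + sg b * t) b - g x b -
   turn e b * (lambda * \int[lebesgue_measure]_(r in `[0, t[) Y n r).
have D1 : D n @[n --> \oo] --> v t (x + sg b * t) b - g x b -
   turn e b * (lambda * \int[lebesgue_measure]_(r in `[0, t[) v r (x + sg b * r) (~~ b)).
  apply: cvgB.
    apply: cvgB; last exact: cvg_cst.
    have := @walk_cvg _ _ _ _ _ _ lambda0 HN e g M h succn t
      (fun n => x + sg b * t) (x + sg b * t) b cg gM.
    apply=> //; first exact: ltW.
    - by move=> n; rewrite hE.
    - by under eq_fun do rewrite hE; exact: cvg_cst.
    - exact: cvg_cst.
  by apply: cvgM; [exact: cvg_cst|apply: cvgM => //; exact: cvg_cst].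
have D2 : D n @[n --> \oo] --> 0.
  pose r n := (`|cos (a n) - 1| + `|sin (a n) - a n * cos (a n)| +
    `|a n * sin (a n)|) / a n.
  have rc : r n @[n --> \oo] --> 0.
    have c1 : (cos (a n) - 1) / a n @[n --> \oo] --> (0 : R).
      by move: cos_c; rewrite sin0 oppr0 cos0.
    have s1 : sin (a n) / a n @[n --> \oo] --> (1 : R).
      by move: sin_c; rewrite cos0 sin0; under eq_fun do rewrite subr0.
    have cc : cos (a n) @[n --> \oo] --> (1 : R).
      rewrite -(@cos0 R).
      exact (@continuous_cvg _ _ _ _ _ a (@cos R) 0 (@continuous_cos R 0) ac).
    have sc : sin (a n) @[n --> \oo] --> (0 : R).
      rewrite -(@sin0 R).
      exact (@continuous_cvg _ _ _ _ _ a (@sin R) 0 (@continuous_sin R 0) ac).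
    have -> : r = fun n => `|(cos (a n) - 1) / a n| +
        `|sin (a n) / a n - cos (a n)| + `|sin (a n)|.
      apply/funext => n.
      have nE (z : R) : `|z| / a n = `|z / a n|.
        by rewrite normf_div (gtr0_norm (a0 n)).
      rewrite /r 2!mulrDl !nE.
      rewrite (_ : a n * sin (a n) / a n = sin (a n)); last by field; exact: an.
      rewrite (_ : (sin (a n) - a n * cos (a n)) / a n =
        sin (a n) / a n - cos (a n))//.
      by field; exact: an.
    have := cvgD (cvgD (cvg_norm c1) (cvg_norm (cvgB s1 cc))) (cvg_norm sc).
    by rewrite subrr normr0 !addr0; exact.
  apply: (@cvg_of_dist_le _ _ _ _ _ _ (fun n => lambda * t * r n * C)).
    rewrite -[X in _ --> X](_ : lambda * t * 0 * C = 0); last by ring.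
    apply: cvgM; last exact: cvg_cst.
    by apply: cvgM => //; exact: cvg_cst.
  apply: nearW => n; rewrite subr0 /D YE.
  have := @walk_defect (h n) x C n.+1 b (wC n).
  rewrite hE -(mulrA lambda (h n) (\sum_(j < _) _)) => /le_trans; apply.
  rewrite -/(a n) (_ : lambda * t = n.+1%:R * a n); last by rewrite -(hE n) /a; ring.
  by rewrite /r le_eqVlt; apply/orP; left; apply/eqP; field; exact: an.
have D0 := cvg_unique (@Rhausdorff R) D1 D2.
apply/eqP; rewrite -subr_eq0 opprD addrA; apply/eqP; exact: D0.
Qed.

End Duhamel.

(** * Joint continuity and the derivative along characteristics *)

Lemma cvg_joint {R : realType} {I : Type} (F : set_system I) {FF : Filter F}
    (f : R -> R -> R) (u w : I -> R) (a b : R) :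
  {for (a, b), continuous (fun p : R * R => f p.1 p.2)} ->
  u @ F --> a -> w @ F --> b -> (fun i => f (u i) (w i)) @ F --> f a b.
Proof.
move=> cf ua wb.
exact (@continuous_cvg _ _ _ _ _ (fun i => (u i, w i))
  (fun p : R * R => f p.1 p.2) (a, b) cf (cvg_pair ua wb)).
Qed.

Lemma continuous_max0 {R : realType} : continuous (fun t : R => Num.max 0 t).
Proof.
move=> t; apply: (@continuous_max R R (cst 0) id t); first exact: cst_continuous.
exact: cvg_id.
Qed.

Section Characteristics.
Context {R : realType} d {Omega : measurableType d} {P : probability Omega R}.
Context {lambda : R} {N : R -> {RV P >-> nat}}.
Hypotheses (lambda0 : 0 < lambda) (HN : poisson_process lambda N).
Variable e : bool.
Variables (g : R -> bool -> R) (M : R).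
Hypotheses (cg : forall b, continuous (g ^~ b)) (gM : forall y b, `|g y b| <= M).

Local Notation v := (real_psi (lambda := lambda) (N := N) e g).

Lemma measurable_characteristic x b (D : set R) (t : R) : measurable D ->
  D `<=` `[0, t[ -> measurable_fun D (fun r => v r (x + sg b * r) (~~ b)).
Proof.
move=> mD D0; case: (ltP 0 t) => t0.
  have [m _] := duhamel_co lambda0 HN e cg gM x b t0.
  exact: measurable_funS m.
rewrite (_ : D = set0); first exact: measurable_fun_set0.
apply/seteqP; split=> // r /D0 /=; rewrite in_itv /= => /andP[r0 rt].
by have := le_lt_trans r0 rt; rewrite ltNge t0.
Qed.

Lemma real_psi_le r t y b : 0 <= r -> r <= t -> `|v r y b| <= expR (lambda * t) * M.
Proof.
move=> r0 rt; rewrite (le_trans (real_psi_bounded (lambda := lambda) HN e y b r0 cg gM))//.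
by rewrite ler_wpM2r ?(bound_ge0 gM)// ler_expR ler_wpM2l// ltW.
Qed.

Lemma integrable_characteristic x b (b1 b2 : bool) (s t : R) : 0 <= s ->
  (@lebesgue_measure R).-integrable [set` Interval (BSide b1 s) (BSide b2 t)]
    (EFin \o (fun r => v r (x + sg b * r) (~~ b))).
Proof.
move=> s0.
have sub : [set` Interval (BSide b1 s) (BSide b2 t)] `<=` `[0, (t + 1)[.
  apply: subset_itv; first by rewrite bnd_simp; case: b1.
  by rewrite leBSide; case: b2; rewrite /= ?lerDl ?ltrDl.
apply: (integrable_bounded (M := expR (lambda * (t + 1)) * M)) => //.
- exact: lebesgue_itv_lty.
- exact: measurable_characteristic sub.
- move=> r /sub /=; rewrite in_itv /= => /andP[r0 /ltW rt].
  exact: real_psi_le.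
Qed.

Lemma duhamel t x b : 0 <= t -> v t (x + sg b * t) b = g x b + turn e b * (lambda *
    \int[lebesgue_measure]_(r in `[0, t]) v r (x + sg b * r) (~~ b)).
Proof.
rewrite le_eqVlt => /predU1P[<-|t0].
  by rewrite set_itv1 Rintegral_set1 !mulr0 !addr0 (real_psi0 HN).
have [_ ->] := duhamel_co lambda0 HN e cg gM x b t0.
by rewrite Rintegral_itv_bndo_bndc//; exact: integrable_characteristic.
Qed.

(** Lipschitz regularity in time comes from the Duhamel integrand being
    bounded, whatever the regularity of the data. *)
Lemma characteristic_lip s t x b : 0 <= s -> s <= t ->
  `|v t (x + sg b * t) b - v s (x + sg b * s) b| <=
  lambda * (t - s) * (expR (lambda * t) * M).
Proof.
move=> s0 st; rewrite !duhamel//; last exact: le_trans st.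
rewrite opprD addrACA subrr add0r -mulrBr -mulrBr normrM turn_norm mul1r.
rewrite Rintegral_itvB//; last exact: integrable_characteristic.
rewrite normrM gtr0_norm// -mulrA ler_wpM2l ?(ltW lambda0)// mulrC.
rewrite -(lebesgue_itv_fine false false st).
apply: normr_Rintegral_le => //.
- exact: lebesgue_itv_lty.
- by have /integrableP[/measurable_EFinP] :=
    integrable_characteristic x b false false t s0.
- move=> r /=; rewrite in_itv /= => /andP[/ltW sr rt].
  by apply: real_psi_le => //; exact: le_trans sr.
Qed.

Lemma real_psi_dist_le s t y b : 0 <= s -> 0 <= t ->
  `|v s y b - v t (y - sg b * (s - t)) b| <=
  lambda * `|s - t| * (expR (lambda * (Num.max s t)) * M).
Proof.
move=> s0 t0.
have E1 : y = (y - sg b * s) + sg b * s by ring.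
have E2 : y - sg b * (s - t) = (y - sg b * s) + sg b * t by ring.
rewrite {1}E1 E2.
case: (leP s t) => st.
  by rewrite distrC (distrC s) (@ger0_norm _ (t - s)) ?subr_ge0// characteristic_lip.
by rewrite (@ger0_norm _ (s - t)) ?subr_ge0 ?(ltW st)// characteristic_lip// ltW.
Qed.

(** Frozen at its initial value for negative times, so that continuity and
    integration need no one-sided statements at t = 0. *)
Definition psi_ext (t y : R) (b : bool) : R := v (Num.max 0 t) y b.

Lemma psi_extE t y b : 0 <= t -> psi_ext t y b = v t y b.
Proof. by move=> t0; rewrite /psi_ext max_r. Qed.

(** A point is reached by following the characteristic up to the right time,
    which is Lipschitz, and then moving in space at a fixed time. *)
Lemma psi_ext_continuous b : continuous (fun p : R * R => psi_ext p.1 p.2 b).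
Proof.
move=> [t y].
set t' := Num.max 0 t.
have t'0 : 0 <= t' by rewrite le_max lexx.
pose q (p : R * R) := Num.max 0 p.1.
have qc : q p @[p --> (t, y)] --> t'.
  exact (@continuous_cvg _ R R _ _ (fun p : R * R => p.1) _ t
    (@continuous_max0 R t) cvg_fst).
have yc : p.2 @[p --> (t, y)] --> y by exact: cvg_snd.
(* The value at time t' on the characteristic through p. *)
pose F (p : R * R) := v t' (p.2 - sg b * (q p - t')) b.
have Fc : F p @[p --> (t, y)] --> psi_ext t y b.
  have arg : p.2 - sg b * (q p - t') @[p --> (t, y)] --> y.
    rewrite -[X in _ --> X](_ : y - sg b * (t' - t') = y); last by ring.
    apply: cvgB => //; apply: cvgM; first exact: cvg_cst.
    by apply: cvgB => //; exact: cvg_cst.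
  exact (@continuous_cvg _ R R _ _ _ (fun z => v t' z b) y
    (real_psi_continuous_space (lambda := lambda) HN (e := e) t'0 cg gM (b := b) (x:=y)) arg).
have Dc : psi_ext p.1 p.2 b - F p @[p --> (t, y)] --> (0 : R).
  apply: (@cvg_of_dist_le _ _ _ _ _ _ (fun p =>
     lambda * `|q p - t'| * (expR (lambda * (t' + 1)) * M))).
    rewrite -[X in _ --> X](_ : lambda * `|t' - t'| *
        (expR (lambda * (t' + 1)) * M) = 0); last first.
      by rewrite subrr normr0 mulr0 mul0r.
    apply: cvgM; last exact: cvg_cst.
    apply: cvgM; first exact: cvg_cst.
    by apply: cvg_norm; apply: cvgB => //; exact: cvg_cst.
  have q1 : \forall p \near (t, y), q p <= t' + 1.
    by apply: cvgr_le qc _ _; rewrite ltrDl.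
  near=> p; rewrite subr0 /F /psi_ext -/(q p).
  rewrite (le_trans (real_psi_dist_le _ _ _ _))//; first by rewrite le_max lexx.
  apply: ler_wpM2l; first by rewrite mulr_ge0// ltW.
  rewrite ler_wpM2r ?(bound_ge0 gM)// ler_expR ler_wpM2l ?(ltW lambda0)//.
  by rewrite ge_max lerDl ler01 andbT; near: p.
have : F p + (psi_ext p.1 p.2 b - F p) @[p --> (t, y)] --> psi_ext t y b + 0.
  exact: cvgD.
by rewrite addr0; under eq_fun do rewrite addrC subrK; exact.
Unshelve. all: by end_near. Qed.

Lemma psi_ext_characteristic (t x : R) b : 0 < t ->
  is_derive t (1 : R) (fun s => psi_ext s (x + sg b * s) b)
    (turn e b * lambda * psi_ext t (x + sg b * t) (~~ b)).
Proof.
move=> t0.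
pose f r := psi_ext r (x + sg b * r) (~~ b).
have cf : continuous f.
  move=> s; apply: (@cvg_joint _ _ _ _ (fun a c => psi_ext a c (~~ b)) id).
  - exact: psi_ext_continuous.
  - exact: cvg_id.
  - apply: cvgD; first exact: cvg_cst.
    by apply: cvgM; [exact: cvg_cst|exact: cvg_id].
have fE s : 0 <= s -> \int[lebesgue_measure]_(r in `[0, s]) f r =
    \int[lebesgue_measure]_(r in `[0, s]) v r (x + sg b * r) (~~ b).
  move=> s0; apply: eq_Rintegral => r /set_mem /=; rewrite in_itv /= => /andP[r0 _].
  exact: psi_extE.
have intf : (@lebesgue_measure R).-integrable `[0, t + 1] (EFin \o f).
  apply: continuous_compact_integrable; first exact: segment_compact.
  by apply: continuous_subspaceT.
have [dF FE] := continuous_FTC1_closed (f := f) (a := 0) (x := t) (u := t + 1)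
  ltac:(by rewrite ltrDl) intf t0 (cf t).
set F := (fun s : R => _) in dF FE.
rewrite derive1E in FE.
have isF : is_derive t (1 : R) F (f t) := DeriveDef dF FE.
apply: (@near_eq_is_derive _ _ _ (fun s => g x b + turn e b * lambda * F s)).
  near=> s; have s0 : 0 <= s by apply: ltW; near: s; exact: lt_nbhsr.
  by rewrite psi_extE// duhamel// -fE// mulrA.
rewrite -[X in is_derive _ _ _ X](_ : 0 + (turn e b * lambda) *: f t = _); last first.
  by rewrite add0r.
apply: is_deriveD.
Unshelve. all: by end_near. Qed.

End Characteristics.

(** * Classical solutions *)

Lemma is_derive_of_dist_le {R : realType} (f : R -> R) (t L : R) :
  (forall eps, 0 < eps -> \forall s \near t,
     `|f s - f t - (s - t) * L| <= eps * `|s - t|) ->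
  is_derive t (1 : R) f L.
Proof.
move=> H.
have c : h^-1 *: (f (h *: (1 : R) + t) - f t) @[h --> 0^'] --> L.
  apply/cvgrPdist_le => eps eps0.
  have := H _ eps0; rewrite (near_shift 0 t) => Hn.
  near=> h.
  have h_neq0 : h != 0 by near: h; exact: nbhs_dnbhs_neq.
  rewrite [h *: _]mulr1.
  have : `|f (h + t) - f t - h * L| <= eps * `|h|.
    have -> : h * L = (h + t - t) * L by rewrite addrK.
    have -> : `|h| = `|h + t - t| by rewrite addrK.
    near: h; apply: nbhs_dnbhs.
    by move: Hn; rewrite subr0.
  rewrite -ler_pdivrMr ?normr_gt0// -normf_div distrC; congr (`|_| <= _).
  by rewrite mulrBl mulrAC divff// mul1r [_ *: _]mulrC.
apply: DeriveDef; first by apply/cvg_ex; exists L.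
by apply/cvg_lim => //; exact: Rhausdorff.
Unshelve. all: by end_near. Qed.

(** Increments of either sign are treated at once; differentiability on the
    closed half-line also gives the continuity at both endpoints. *)
Lemma MVT_sym {R : realType} (f df : R -> R) (a b : R) :
  (forall r, Num.min a b <= r -> is_derive r (1 : R) f (df r)) ->
  exists2 r, `|r - a| <= `|b - a| & f b - f a = (b - a) * df r.
Proof.
move=> fdf; case: (ltgtP a b) => ab; last first.
- by exists a; [rewrite subrr normr0|rewrite ab !subrr mul0r].
- have ba_df r : r \in `]b, a[ -> is_derive r 1 f (df r).
    rewrite in_itv /= => /andP[br _]; apply: fdf.
    by rewrite min_r ?(ltW ab)// ltW.
  have cf : {within `[b, a], continuous f}.
    apply: derivable_within_continuous => r; rewrite in_itv /= => /andP[br _].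
    have rmin : Num.min a b <= r by rewrite min_r ?(ltW ab).
    by have [] := fdf r rmin.
  have [r] := MVT ab ba_df cf; rewrite in_itv /= => /andP[br ra] E.
  exists r; last by rewrite -opprB E mulrC -mulNr opprB.
  by rewrite distrC (distrC b) !gtr0_norm ?subr_gt0// lerB// ltW.
- have ab_df r : r \in `]a, b[ -> is_derive r 1 f (df r).
    rewrite in_itv /= => /andP[ar _]; apply: fdf.
    by rewrite min_l ?(ltW ab)// ltW.
  have cf : {within `[a, b], continuous f}.
    apply: derivable_within_continuous => r; rewrite in_itv /= => /andP[ar _].
    have rmin : Num.min a b <= r by rewrite min_l ?(ltW ab).
    by have [] := fdf r rmin.
  have [r] := MVT ab ab_df cf; rewrite in_itv /= => /andP[ar rb] E.
  exists r; last by rewrite E mulrC.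
  by rewrite !gtr0_norm ?subr_gt0// lerB// ltW.
Qed.

(** Exchange of directions.  If F has a derivative D along the lines of slope a,
    and D is continuous at a point where F has a derivative l in space, then F
    has a derivative there along any slope c: the increment is split at the point where the line of
    slope a through the end of the increment meets the initial time, and the
    mean value theorem is applied on that line. *)
Lemma derive_slant {R : realType} (F D : R -> R -> R) (a c l t y : R) :
  0 < t ->
  (forall s x : R, 0 < s ->
     is_derive s (1 : R) (fun r => F r (x + a * r)) (D s (x + a * s))) ->
  {for (t, y), continuous (fun p : R * R => D p.1 p.2)} ->
  is_derive y (1 : R) (F t) l ->
  is_derive t (1 : R) (fun s => F s (y + c * (s - t))) (D t y + (c - a) * l).
Proof.
move=> t0 FD cD Ftl.
(* Split F along the slope c into its trace S at time t and a remainder T. *)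
pose S s := F t (y + (c - a) * (s - t)).
have dS : is_derive t (1 : R) S ((c - a) * l).
  rewrite mulrC; apply: (@is_derive1_comp _ (F t) (fun s => y + (c - a) * (s - t))).
    by rewrite subrr mulr0 addr0.
  rewrite -[X in is_derive _ _ _ X](_ : 0 + (c - a) *: (1 - 0) = c - a).
    exact: is_deriveD.
  by rewrite add0r subr0 /GRing.scale /= mulr1.
pose T s := F s (y + c * (s - t)) - S s.
have dT : is_derive t (1 : R) T (D t y).
  apply: is_derive_of_dist_le => eps eps0.
  have : \forall p \near (t, y), `|D t y - D p.1 p.2| <= eps.
    by move/cvgrPdist_le : cD; exact.
  case=> [[/= U V] [[u /= u0 tU] [w /= w0 yV]] UV].
  pose K := `|c - a| + `|a| + 1.
  have K0 : 0 < K by rewrite ltr_wpDl// addr_ge0.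
  have nt : \forall s \near t, `|t - s| < Num.min (Num.min u (w / K)) t.
    have : s @[s --> t] --> t by exact: cvg_id.
    by move/cvgrPdist_lt; apply; rewrite !lt_min u0 divr_gt0//.
  near=> s.
  have : `|t - s| < Num.min (Num.min u (w / K)) t by near: s.
  rewrite !lt_min => /andP[/andP[su sw] st].
  have s0 : 0 < s.
    by move: (le_lt_trans (ler_norm _) st); rewrite ltrBlDr ltrDl.
  pose x := y + (c - a) * (s - t) - a * t.
  have [r rt E] : exists2 r, `|r - t| <= `|s - t| &
      F s (x + a * s) - F t (x + a * t) = (s - t) * D r (x + a * r).
    apply: (@MVT_sym _ (fun r => F r (x + a * r)) (fun r => D r (x + a * r))).
    move=> r; rewrite ge_min => /orP[tr|sr]; apply: FD.
      exact: lt_le_trans tr.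
    exact: lt_le_trans sr.
  have TE : T s - T t = (s - t) * D r (x + a * r).
    rewrite /T /S -E !subrr !mulr0 !addr0 subrr subr0.
    by congr (F _ _ - F _ _); rewrite /x; ring.
  rewrite TE -mulrBr normrM mulrC ler_wpM2r// distrC.
  apply: (UV (r, x + a * r)); split => /=.
    by apply: tU => /=; rewrite distrC (le_lt_trans rt)// distrC.
  apply: yV => /=.
  rewrite (_ : y - _ = - ((c - a) * (s - t) + a * (r - t))); last by rewrite /x; ring.
  rewrite normrN (le_lt_trans (ler_normD _ _))// !normrM.
  rewrite distrC in sw.
  rewrite (@le_lt_trans _ _ (K * `|s - t|))//; last by rewrite mulrC -ltr_pdivlMr.
  rewrite /K !mulrDl mul1r -addrA lerD2l (le_trans (ler_wpM2l _ rt))//.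
  by rewrite lerDl.
rewrite (_ : (fun s => _) = T \+ S).
  exact: is_deriveD.
by apply/funext => s /=; rewrite /T subrK.
Unshelve. all: by end_near. Qed.

Lemma continuous_bounded_segment {R : realType} (f : R -> R) (a b : R) :
  continuous f -> exists2 K, 0 <= K & forall x, a <= x <= b -> `|f x| <= K.
Proof.
move=> cf; have [ab|ba] := leP a b; last first.
  exists 0 => // x /andP[ax xb]; have := le_trans ax xb; by rewrite leNgt ba.
have cn : {within `[a, b], continuous (fun x => `|f x|)}.
  apply: continuous_subspaceT => x; apply: cvg_norm; exact: cf.
have [c _ cP] := EVT_max ab cn.
by exists `|f c| => // x xab; apply: cP; rewrite in_itv.
Qed.

Section Classical.
Context {R : realType} d {Omega : measurableType d} {P : probability Omega R}.
Context {lambda : R} {N : R -> {RV P >-> nat}}.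
Hypotheses (lambda0 : 0 < lambda) (HN : poisson_process lambda N).
Variable e : bool.
Variables (g dg : R -> bool -> R) (M : R).
Hypotheses (cg : forall b, continuous (g ^~ b)) (gM : forall y b, `|g y b| <= M).
Hypotheses (cdg : forall b, continuous (dg ^~ b))
  (gdg : forall x b, is_derive x (1 : R) (g ^~ b) (dg x b)).

Local Notation v := (real_psi (lambda := lambda) (N := N) e g).

(** The displacement is at most t, so only the values of the derivative of g on a
    bounded interval matter; they are bounded, which allows differentiation
    under the expectation even if the derivative of g is unbounded on R. *)
Lemma derivable_space (t y : R) b : 0 <= t -> derivable (v t ^~ b) y 1.
Proof.
move=> t0.
pose f (x : R) (w : Omega) := flow (N := N) e g t x b w.
have df x w : is_derive x (1 : R) (f ^~ w)
    (phase e b (N t w) * dg (x - sg b * displacement (N := N) t w) (b (+) odd (N t w))).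
  set p := phase _ _ _; set c := sg b * _; set b' := b (+) _.
  have dsub : is_derive x (1 : R) (fun x => x - c) 1.
    by rewrite -[X in is_derive _ _ _ X]subr0; exact: is_deriveB.
  have := @is_derive1_comp _ (g ^~ b') (fun x => x - c) x _ _ (gdg (x - c) b') dsub.
  by rewrite mulr1 => dg'; exact: (@is_deriveZ _ _ _ ((g ^~ b') \o (fun x => x - c)) p).
have [K0 K00 HK0] := continuous_bounded_segment
  (y - 1 - t) (y + 1 + t) (cdg (b := false)).
have [K1 K10 HK1] := continuous_bounded_segment
  (y - 1 - t) (y + 1 + t) (cdg (b := true)).
have PT : (P setT < +oo)%E by rewrite ltey_eq fin_num_measure.
have yI : `]y - 1, y + 1[%classic y.
  by rewrite /= in_itv /= ltrBlDr !ltrDl ltr01.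
suff : derivable (fun x => \int[P]_w f x w) y 1 by exact: derivableZ.
apply: (@derivable_under_integral _ _ _ P f setT measurableT y (y - 1) (y + 1) yI
  _ _ (fun=> K0 + K1)).
- move=> x _; apply: (integrable_bounded (M := M)) => //.
    exact: (measurable_flow HN).
  by move=> w _; rewrite /f /flow normrM phase_norm mul1r.
- by move=> x w _ _; have [] := df x w.
- by move=> _; rewrite addr_ge0.
- apply: (integrable_bounded (M := `|K0 + K1|)) => //.
- move=> x w /=; rewrite in_itv /= => /andP[yx xy] _.
  rewrite partial1of2E.
  have [_ ->] := df x w.
  rewrite normrM phase_norm mul1r.
  have : `|sg b * displacement (N := N) t w| <= t.
    by rewrite normrM sg_norm mul1r (displacement_le HN).
  rewrite ler_norml => /andP[c1 c2].
  have xI : y - 1 - t <= x - sg b * displacement (N := N) t w <= y + 1 + t.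
    by apply/andP; split; lra.
  case: (b (+) _); first by rewrite (le_trans (HK1 _ xI))// lerDr.
  by rewrite (le_trans (HK0 _ xI))// lerDl.
Qed.

Lemma real_classical (t y : R) b : 0 < t -> exists l : R,
  is_derive y (1 : R) (v t ^~ b) l /\
  is_derive t (1 : R) (fun s => v s y b)
    (turn e b * lambda * v t y (~~ b) - sg b * l).
Proof.
move=> t0.
have dv := @derivable_space t y b (ltW t0).
exists ('D_1 (v t ^~ b) y); split; first exact: DeriveDef.
have E : psi_ext (lambda := lambda) (N := N) e g t ^~ b = v t ^~ b.
  by apply/funext => x; rewrite psi_extE// ltW.
set l := 'D_1 _ y.
pose D (s x : R) :=
  turn e b * lambda * psi_ext (lambda := lambda) (N := N) e g s x (~~ b).
have cD : {for (t, y), continuous (fun p : R * R => D p.1 p.2)}.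
  apply: cvgM; first exact: cvg_cst.
  exact: (@psi_ext_continuous _ _ _ _ _ _ lambda0 HN e _ _ cg gM (~~ b) (t, y)).
have dF (s x : R) : 0 < s -> is_derive s (1 : R)
    (fun r => psi_ext (lambda := lambda) (N := N) e g r (x + sg b * r) b)
    (D s (x + sg b * s)).
  by move=> s0; exact: (psi_ext_characteristic lambda0 HN e cg gM).
have dl : is_derive y (1 : R)
    ((fun s x => psi_ext (lambda := lambda) (N := N) e g s x b) t) l.
  by rewrite E; exact: DeriveDef.
have H := @derive_slant _ (fun s x => psi_ext (lambda := lambda) (N := N) e g s x b)
  D (sg b) 0 l t y t0 dF cD dl.
have -> : turn e b * lambda * v t y (~~ b) - sg b * l = D t y + (0 - sg b) * l.
  by rewrite /D psi_extE ?ltW// sub0r mulNr.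
apply: near_eq_is_derive H.
near=> s; rewrite mul0r addr0 psi_extE//; apply: ltW; near: s; exact: lt_nbhsr.
Unshelve. all: by end_near. Qed.

End Classical.

(** * Jointly continuous functions and test functions *)

Section Joint.
Context {R : realType}.
Implicit Types (f g : R -> R -> R).

Definition jcontinuous f := continuous (fun p : R * R => f p.1 p.2).

Lemma jcontinuousM f g : jcontinuous f -> jcontinuous g ->
  jcontinuous (fun t x => f t x * g t x).
Proof. by move=> cf cg p; apply: cvgM; [exact: cf|exact: cg]. Qed.

Lemma jcontinuousD f g : jcontinuous f -> jcontinuous g ->
  jcontinuous (fun t x => f t x + g t x).
Proof. by move=> cf cg p; apply: cvgD; [exact: cf|exact: cg]. Qed.

Lemma jcontinuous_cst (c : R) : jcontinuous (fun _ _ => c).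
Proof. by move=> p; exact: cvg_cst. Qed.

Lemma jcontinuous_shear f (c : R) : jcontinuous f ->
  jcontinuous (fun t x => f t (x + c * t)).
Proof.
move=> cf [t x]; apply: (@cvg_joint _ _ _ _ f fst).
- exact: cf.
- exact: cvg_fst.
- apply: cvgD; first exact: cvg_snd.
  by apply: cvgM; [exact: cvg_cst|exact: cvg_fst].
Qed.

Lemma jcontinuous_slice f t : jcontinuous f -> continuous (f t).
Proof.
move=> cf x; apply: (@cvg_joint _ _ _ _ f (fun=> t)).
- exact: cf.
- exact: cvg_cst.
- exact: cvg_id.
Qed.

Definition box_support f (M : R) := forall t x, M < `|t| \/ M < `|x| -> f t x = 0.

Lemma jcontinuous_bounded f M : jcontinuous f -> box_support f M ->
  exists2 K, 0 <= K & forall t x, `|f t x| <= K.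
Proof.
move=> cf fM.
pose B := `[- M, M]%classic `*` `[- M, M]%classic : set (R * R).
have cB : compact B by apply: compact_setX; exact: segment_compact.
have cfB : compact [set f p.1 p.2 | p in B].
  apply: continuous_compact => //.
  by apply: continuous_subspaceT.
have [K [Kr HK]] := compact_bounded cfB.
exists (`|K| + 1); first by rewrite addr_ge0.
move=> t x.
have [tM|tM] := boolP (M < `|t|); first by rewrite fM ?normr0 ?addr_ge0//; left.
have [xM|xM] := boolP (M < `|x|); first by rewrite fM ?normr0 ?addr_ge0//; right.
apply: (HK (`|K| + 1)); first by rewrite (le_lt_trans (ler_norm _))// ltrDl.
exists (t, x) => //=; split; by rewrite /= in_itv /= -ler_norml leNgt.
Qed.

Lemma continuous_parametric f K (a b : R) : jcontinuous f ->
  (forall t x, `|f t x| <= K) ->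
  continuous (fun t => \int[lebesgue_measure]_(x in `[a, b]) f t x).
Proof.
move=> cf fK t; apply/(@cvg_nbhsP _ R^o) => u ut.
apply: (proj2 (@bounded_convergence _ _ _ (@lebesgue_measure R) `[a, b]
  (fun n => f (u n)) (f t) K _ _ _ _ _)) => //.
- exact: lebesgue_itv_lty.
- move=> n; apply: measurable_funTS; apply: continuous_measurable_fun.
  exact: jcontinuous_slice.
- move=> x _; apply: (@cvg_joint _ _ _ _ f u (fun=> x)) => //.
  - exact: cf.
  - exact: cvg_cst.
Qed.

Lemma Rintegral_shift (G : R -> R) (a b c : R) : a <= b -> continuous G ->
  \int[lebesgue_measure]_(y in `[a + c, b + c]) G y =
  \int[lebesgue_measure]_(x in `[a, b]) G (x + c).
Proof.
move=> ab cG.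
have dF (x : R) : is_derive x (1 : R) (fun x => x + c) 1.
  by rewrite -[X in is_derive _ _ _ X]addr0; exact: is_deriveD.
have F'E : (fun x => x + c : R)^`()%classic = cst 1.
  by apply/funext => x; rewrite derive1E; have [_ ->] := dF x.
rewrite /Rintegral (@integration_by_substitution_increasing _ (fun x => x + c))//.
- congr fine; apply: eq_integral => x _.
  by rewrite F'E /= mulr1.
- by move=> x y _ _ xy; rewrite ltrD2r.
- by rewrite F'E => x _; exact: cst_continuous.
- by rewrite F'E; exact: is_cvg_cst.
- by rewrite F'E; exact: is_cvg_cst.
- have cF (x : R) : (fun x => x + c) @ x --> x + c.
    by apply: cvgD; [exact: cvg_id|exact: cvg_cst].
  split.
  + by move=> x _; have [] := dF x.
  + by apply: cvg_at_right_filter; exact: cF.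
  + by apply: cvg_at_left_filter; exact: cF.
- by apply: continuous_subspaceT.
Qed.

Lemma Rintegral_support d (T : measurableType d) (mu : {measure set T -> \bar R})
    (A B : set T) (f : T -> R) :
  (forall x, A x -> ~ B x -> f x = 0) -> (forall x, B x -> ~ A x -> f x = 0) ->
  \int[mu]_(x in A) f x = \int[mu]_(x in B) f x.
Proof.
move=> AB BA; rewrite Rintegral_mkcond [RHS]Rintegral_mkcond.
apply: eq_Rintegral => x _; rewrite !patchE.
case: (boolP (x \in A)) => xA; case: (boolP (x \in B)) => xB //.
- by apply: AB; [exact/set_mem|move/mem_set; exact/negP].
- by apply/esym/BA; [exact/set_mem|move/mem_set; exact/negP].
Qed.

End Joint.

Section Test_function.
Context {R : realType}.
Variable phi : R -> R -> R.
Hypothesis tphi : test_function phi.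

Lemma test_support : exists2 M : R, 0 < M &
  [/\ box_support phi M, box_support (d_t phi) M & box_support (d_y phi) M].
Proof.
have [_ _ _ [M HM]] := tphi.
exists (`|M| + 1); first by rewrite ltr_wpDl.
have lt1 : M < `|M| + 1 by rewrite (le_lt_trans (ler_norm _))// ltrDl.
have H0 : box_support phi M by [].
have near_gt (x : R) : M < `|x| -> \forall s \near x, M < `|s|.
  move=> Mx; have : `|s| @[s --> x] --> `|x| by apply: cvg_norm; exact: cvg_id.
  by move/cvgr_gt; apply.
have zero (f : R -> R) (x : R) : (\forall s \near x, f s = 0) -> derive1 f x = 0.
  move=> f0; rewrite derive1E.
  have -> : 'D_1 f x = 'D_1 (cst (0 : R)) x.
    by apply: near_eq_derive; exact: f0.
  exact: derive_cst.
split=> t x tx.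
- apply: H0; case: tx => [tM|xM]; [left|right]; exact: lt_trans lt1 _.
- rewrite /d_t; apply: zero; case: tx => [tM|xM].
    have := near_gt _ (lt_trans lt1 tM).
    by apply: filterS => s sM; apply: H0; left.
  by near=> s; apply: H0; right; exact: lt_trans lt1 xM.
- rewrite /d_y; apply: zero; case: tx => [tM|xM].
    by near=> s; apply: H0; left; exact: lt_trans lt1 tM.
  have := near_gt _ (lt_trans lt1 xM).
  by apply: filterS => s sM; apply: H0; right.
Unshelve. all: by end_near. Qed.

Lemma test_derive_t (t x : R) : is_derive t (1 : R) (phi ^~ x) (d_t phi t x).
Proof.
have [dphi _ _ _] := tphi; have [dt _] := dphi t x.
by apply: DeriveDef => //; rewrite /d_t derive1E.
Qed.

Lemma test_derive_y (t x : R) : is_derive x (1 : R) (phi t) (d_y phi t x).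
Proof.
have [dphi _ _ _] := tphi; have [_ dy] := dphi t x.
by apply: DeriveDef => //; rewrite /d_y derive1E.
Qed.

(** Bounded partial derivative in time (by compactness of the support) and
    continuity in space. *)
Lemma test_jcontinuous : jcontinuous phi.
Proof.
have [M M0 [_ dtM _]] := test_support.
have [_ cdt _ _] := tphi.
have [K K0 HK] := jcontinuous_bounded cdt dtM.
move=> [t y].
have c1 : phi t p.2 @[p --> (t, y)] --> phi t y.
  have cphi : {for y, continuous (phi t)}.
    apply: differentiable_continuous; apply/derivable1_diffP.
    by have [] := test_derive_y t y.
  exact (@continuous_cvg _ _ _ _ _ (fun p : R * R => p.2) (phi t) y cphi cvg_snd).
have c2 : phi p.1 p.2 - phi t p.2 @[p --> (t, y)] --> (0 : R).
  apply: (@cvg_of_dist_le _ _ _ _ _ _ (fun p => `|p.1 - t| * K)).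
    rewrite -[X in _ --> X](_ : `|t - t| * K = 0); last first.
      by rewrite subrr normr0 mul0r.
    apply: cvgM; last exact: cvg_cst.
    by apply: cvg_norm; apply: cvgB; [exact: cvg_fst|exact: cvg_cst].
  apply: nearW => p; rewrite subr0.
  have [r _ ->] := @MVT_sym _ (phi ^~ p.2) (d_t phi ^~ p.2) t p.1
    (fun r _ => test_derive_t r p.2).
  by rewrite normrM ler_wpM2l.
have : phi t p.2 + (phi p.1 p.2 - phi t p.2) @[p --> (t, y)] --> phi t y + 0.
  exact: cvgD.
by rewrite addr0; under eq_fun do rewrite addrC subrK; exact.
Qed.

End Test_function.

(** * The weak formulation *)

Section Weak.
Context {R : realType} d {Omega : measurableType d} {P : probability Omega R}.
Context {lambda : R} {N : R -> {RV P >-> nat}}.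
Hypotheses (lambda0 : 0 < lambda) (HN : poisson_process lambda N).
Variable e : bool.
Variables (g : R -> bool -> R) (M : R).
Hypotheses (cg : forall b, continuous (g ^~ b)) (gM : forall y b, `|g y b| <= M).

Local Notation v := (real_psi (lambda := lambda) (N := N) e g).
Local Notation u := (psi_ext (lambda := lambda) (N := N) e g).

Variable phi : R -> R -> R.
Hypothesis tphi : test_function phi.

Definition weak_integrand b (t y : R) : R :=
  u t y b * (d_t phi t y + sg b * d_y phi t y) +
  turn e b * lambda * u t y (~~ b) * phi t y.

Lemma weak_integrand_jcontinuous b : jcontinuous (weak_integrand b).
Proof.
have [_ cdt cdy _] := tphi.
have cu c : jcontinuous (fun t y => u t y c).
  exact (@psi_ext_continuous _ _ _ _ _ _ lambda0 HN e _ _ cg gM c).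
apply: jcontinuousD; apply: jcontinuousM => //.
- apply: jcontinuousD => //; apply: jcontinuousM => //; exact: jcontinuous_cst.
- by apply: jcontinuousM => //; exact: jcontinuous_cst.
- exact: test_jcontinuous tphi.
Qed.

(** Product rule, the test function being differentiated along the
    characteristic by [derive_slant]. *)
Lemma along_characteristic b (t x : R) : 0 < t ->
  is_derive t (1 : R)
    (fun s => u s (x + sg b * s) b * phi s (x + sg b * s))
    (weak_integrand b t (x + sg b * t)).
Proof.
move=> t0.
have du := psi_ext_characteristic lambda0 HN e cg gM x b t0.
have [_ cdt _ _] := tphi.
have dphi : is_derive t (1 : R) (fun s => phi s (x + sg b * s))
    (d_t phi t (x + sg b * t) + sg b * d_y phi t (x + sg b * t)).
  have dF (s z : R) : 0 < s ->
      is_derive s (1 : R) (fun r => phi r (z + 0 * r)) (d_t phi s (z + 0 * s)).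
    move=> _; rewrite mul0r addr0.
    rewrite (_ : (fun r => _) = phi ^~ z); first exact: (test_derive_t tphi).
    by apply/funext => r; rewrite mul0r addr0.
  have := @derive_slant _ phi (d_t phi) 0 (sg b) (d_y phi t (x + sg b * t)) t
    (x + sg b * t) t0 dF (cdt _) (test_derive_y tphi _ _).
  rewrite subr0 (_ : (fun s => _) = (fun s => phi s (x + sg b * s)))//.
  by apply/funext => s; congr (phi _ _); ring.
rewrite (_ : weak_integrand b t (x + sg b * t) =
    u t (x + sg b * t) b *: (d_t phi t (x + sg b * t) + sg b * d_y phi t (x + sg b * t)) +
    phi t (x + sg b * t) *: (turn e b * lambda * u t (x + sg b * t) (~~ b))).
  exact: is_deriveM.
by rewrite /weak_integrand /GRing.scale /=; ring.
Qed.

Lemma real_weak b :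
  \int[lebesgue_measure]_(t in `[0, +oo[) (\int[lebesgue_measure]_y
     (v t y b * (d_t phi t y + sg b * d_y phi t y) +
      turn e b * lambda * v t y (~~ b) * phi t y)) +
  \int[lebesgue_measure]_y (g y b * phi 0 y) = 0.
Proof.
have [L L0 [pL dtL dyL]] := test_support tphi.
pose K := weak_integrand b.
have cK : jcontinuous K by exact: weak_integrand_jcontinuous.
have KL : box_support K L.
  by move=> t y tyL; rewrite /K /weak_integrand pL// dtL// dyL// !mulr0 !addr0 mulr0.
pose h t y := u t y b * phi t y.
have ch : jcontinuous h.
  apply: jcontinuousM; last exact: test_jcontinuous tphi.
  exact (@psi_ext_continuous _ _ _ _ _ _ lambda0 HN e _ _ cg gM b).
have hL : box_support h L by move=> t y tyL; rewrite /h pL// mulr0.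
(* The test function vanishes after T; up to time T, characteristics that start
   outside [-B, B] stay outside its support. *)
pose T := L + 1; pose B := L + T.
have T0 : 0 < T by rewrite addr_gt0.
have B0 : 0 < B by rewrite addr_gt0.
have far (t x : R) : 0 <= t <= T -> ~ `[- B, B]%classic x -> L < `|x + sg b * t|.
  move=> /andP[t0 tT] /negP; rewrite in_itv /= -ler_norml -ltNge => Bx.
  have : `|x| - `|sg b * t| <= `|x + sg b * t|.
    by have := lerB_normD x (sg b * t).
  by rewrite normrM sg_norm mul1r (ger0_norm t0); move: Bx; rewrite /B; lra.
pose H t := \int[lebesgue_measure]_(x in `[- B, B]) h t (x + sg b * t).
pose K' t := \int[lebesgue_measure]_(x in `[- B, B]) K t (x + sg b * t).
have [CK CK0 HCK] := jcontinuous_bounded cK KL.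
have [Ch Ch0 HCh] := jcontinuous_bounded ch hL.
have cK' : continuous K'.
  by apply: (continuous_parametric (K := CK)) => //; exact: jcontinuous_shear.
have cH : continuous H.
  by apply: (continuous_parametric (K := Ch)) => //; exact: jcontinuous_shear.
have bnd_int (F : R -> R -> R) (C t : R) : jcontinuous F -> (forall t x, `|F t x| <= C) ->
    (@lebesgue_measure R).-integrable `[- B, B] (EFin \o (fun x => F t (x + sg b * t))).
  move=> cF FC; apply: (integrable_bounded (M := C)) => //.
    exact: lebesgue_itv_lty.
  apply: measurable_funTS; apply: continuous_measurable_fun.
  exact: (jcontinuous_slice (jcontinuous_shear (c := sg b) cF)).
have dH (t : R) : 0 < t -> derivable H t 1 /\ H^`()%classic t = K' t.
  move=> t0.
  have tI : `](t / 2), (t + 1)[%classic t.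
    by rewrite /= in_itv /= ltr_pdivrMr// ltrDl ltr01 mulr_natr mulr2n ltrDl t0.
  have I0 (s : R) : `](t / 2), (t + 1)[%classic s -> 0 < s.
    by rewrite /= in_itv /= => /andP[+ _]; apply: lt_trans; rewrite divr_gt0.
  pose f (s x : R) := h s (x + sg b * s).
  have int_f (s : R) : `](t / 2), (t + 1)[%classic s ->
      (@lebesgue_measure R).-integrable `[- B, B] (EFin \o f s).
    by move=> _; exact: (bnd_int h Ch).
  have der_f (s x : R) : `](t / 2), (t + 1)[%classic s -> `[- B, B]%classic x ->
      derivable (f ^~ x) s 1.
    by move=> /I0 s0 _; have [] := along_characteristic b x s0.
  have G0 (x : R) : 0 <= cst CK x by [].
  have int_G : (@lebesgue_measure R).-integrable `[- B, B] (EFin \o cst CK).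
    apply: (integrable_bounded (M := `|CK|)) => //.
    exact: lebesgue_itv_lty.
  have G_ub (s x : R) : `](t / 2), (t + 1)[%classic s -> `[- B, B]%classic x ->
      `|partial1of2 f s x| <= cst CK x.
    move=> /I0 s0 _; rewrite partial1of2E.
    by have [_ ->] := along_characteristic b x s0; exact: HCK.
  split.
    exact (@derivable_under_integral _ _ _ (@lebesgue_measure R) f `[- B, B]
      (measurable_itv _) t (t / 2) (t + 1) tI int_f der_f (cst CK) G0 int_G G_ub).
  have -> := @differentiation_under_integral _ _ _ (@lebesgue_measure R) f `[- B, B]
      (measurable_itv _) t (t / 2) (t + 1) tI int_f der_f (cst CK) G0 int_G G_ub.
  apply: eq_Rintegral => x _ /=; rewrite partial1of2E.
  by have [_ ->] := along_characteristic b x t0.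
have FTC : \int[lebesgue_measure]_(t in `[0, T]) K' t = H T - H 0.
  rewrite /Rintegral (@continuous_FTC2 _ K' H 0 T)//.
  - by apply: continuous_subspaceT.
  - split.
    + by move=> t; rewrite in_itv /= => /andP[/dH[]].
    + by apply: cvg_at_right_filter; exact: cH.
    + by apply: cvg_at_left_filter; exact: cH.
  - by move=> t; rewrite in_itv /= => /andP[/dH[]].
have HT : H T = 0.
  rewrite /H (@eq_Rintegral _ _ _ _ _ (fun=> 0)).
    by rewrite Rintegral_cst// mul0r.
  move=> x _; apply: hL; left.
  by rewrite gtr0_norm// ltrDl.
have H0 : H 0 = \int[lebesgue_measure]_y (g y b * phi 0 y).
  transitivity (\int[lebesgue_measure]_(y in `[- B, B]) (g y b * phi 0 y)).
    apply: eq_Rintegral => x _.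
    by rewrite /h mulr0 addr0 psi_extE// (real_psi0 HN).
  apply: Rintegral_support => x _ xB; first by case: xB.
  rewrite pL ?mulr0//; right.
  have := @far 0 x; rewrite mulr0 addr0; apply => //.
  by rewrite lexx ltW.
have outer : \int[lebesgue_measure]_(t in `[0, +oo[) (\int[lebesgue_measure]_y
     (v t y b * (d_t phi t y + sg b * d_y phi t y) +
      turn e b * lambda * v t y (~~ b) * phi t y)) =
    \int[lebesgue_measure]_(t in `[0, T]) K' t.
  have E t : 0 <= t -> \int[lebesgue_measure]_y
     (v t y b * (d_t phi t y + sg b * d_y phi t y) +
      turn e b * lambda * v t y (~~ b) * phi t y) = \int[lebesgue_measure]_y K t y.
    by move=> t0; apply: eq_Rintegral => y _; rewrite /K /weak_integrand !psi_extE.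
  transitivity (\int[lebesgue_measure]_(t in `[0, T]) (\int[lebesgue_measure]_y
     (v t y b * (d_t phi t y + sg b * d_y phi t y) +
      turn e b * lambda * v t y (~~ b) * phi t y))); last first.
    apply: eq_Rintegral => t /set_mem /=; rewrite in_itv /= => /andP[t0 tT].
    rewrite E// /K' -(Rintegral_shift (G := K t)); last 2 first.
    + by rewrite -subr_ge0 opprK addr_ge0 ?(ltW B0).
    + exact: jcontinuous_slice.
    apply: Rintegral_support => y _ yB; last by case: yB.
    apply: KL; right.
    have := @far t (y - sg b * t); rewrite subrK; apply; first by rewrite t0.
    move=> yB'; apply: yB; move: yB'; rewrite /= !in_itv /=.
    by rewrite lerBrDr lerBlDr.
  apply: Rintegral_support.
  - move=> t /=; rewrite !in_itv /= andbT => t0 /negP.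
    rewrite t0 /= -ltNge => Tt.
    rewrite E// (@eq_Rintegral _ _ _ _ _ (fun=> 0)).
      by rewrite Rintegral_cst// mul0r.
    move=> y _; apply: KL; left.
    by rewrite ger0_norm// (lt_trans _ Tt)// ltrDl.
  - by move=> t /=; rewrite !in_itv /= andbT => /andP[->].
rewrite -H0 -[RHS](addNr (H 0)); congr (_ + _).
transitivity (H T - H 0); last by rewrite HT sub0r.
by rewrite -FTC; exact: outer.
Qed.

End Weak.

(** * Energy *)

Section Energy.
Context {R : realType}.

Lemma integrable_itv_continuous (f : R -> R) (a b : R) : continuous f ->
  (@lebesgue_measure R).-integrable `[a, b] (EFin \o f).
Proof.
move=> cf; apply: continuous_compact_integrable; first exact: segment_compact.
by apply: continuous_subspaceT.
Qed.

Lemma Rintegral_subitv (f : R -> R) (a b c d : R) : continuous f ->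
  (forall x, 0 <= f x) -> c <= a -> b <= d ->
  \int[lebesgue_measure]_(x in `[a, b]) f x <=
  \int[lebesgue_measure]_(x in `[c, d]) f x.
Proof.
move=> cf f0 ca bd; apply: fine_le.
- exact: integrable_fin_num (integrable_itv_continuous _ _ cf).
- exact: integrable_fin_num (integrable_itv_continuous _ _ cf).
- apply: ge0_subset_integral => //.
  + have /integrableP[] := integrable_itv_continuous c d cf; exact.
  + by move=> x _; rewrite lee_fin.
  + by apply: subset_itv; rewrite bnd_simp.
Qed.

Implicit Types (A : R) (n : nat).
Variables (e : bool) (h a : R).
Hypothesis h0 : 0 <= h.
Variable g : R -> bool -> R.
Hypothesis cg : forall b, continuous (g ^~ b).

Definition density (w : R -> bool -> R) (y : R) : R :=
  w y false ^+ 2 + w y true ^+ 2.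

Lemma density_ge0 w y : 0 <= density w y.
Proof. by rewrite addr_ge0// sqr_ge0. Qed.

Lemma sqr_continuous (f : R -> R) : continuous f -> continuous (fun y => f y ^+ 2).
Proof. by move=> cf y; apply: cvgM; exact: cf. Qed.

Lemma density_continuous w : (forall b, continuous (w ^~ b)) ->
  continuous (density w).
Proof.
by move=> cw y; apply: cvgD; apply: sqr_continuous; exact: cw.
Qed.

Local Notation W := (fun n => walk e h a n g).

Lemma walk_continuous n b : continuous (W n ^~ b).
Proof.
elim: n b => [|n IH] b /=; first exact: cg.
move=> y; apply: cvgD; apply: cvgM; try exact: cvg_cst.
- apply: (@continuous_comp _ _ _ (fun z => z - sg b * h) (fun z => W n z b)).
    by apply: cvgB; [exact: cvg_id|exact: cvg_cst].
  exact: IH.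
- apply: (@continuous_comp _ _ _ (fun z => z + sg b * h) (fun z => W n z (~~ b))).
    by apply: cvgD; [exact: cvg_id|exact: cvg_cst].
  exact: IH.
Qed.

(** A rotation preserves the sum of squares, since the two signs of the coupling
    are opposite. *)
Lemma density_walkS n y :
  density (W n.+1) y = W n (y - h) false ^+ 2 + W n (y + h) true ^+ 2.
Proof.
rewrite /density /= /sg /= expr0 expr1 !mul1r !mulN1r opprK.
have -> : turn e true = - turn e false :> R := turnN e false.
set u := W n (y - h) false; set w := W n (y + h) true; set t := turn e false.
have t2 : t ^+ 2 = 1 by rewrite expr2 turn2.
have := cos2Dsin2 a; set c := cos a; set s := sin a => cs.
transitivity ((c ^+ 2 + t ^+ 2 * s ^+ 2) * (u ^+ 2 + w ^+ 2)); first by ring.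
by rewrite t2 mul1r cs mul1r.
Qed.

Lemma energy_walkS n A : 0 <= A ->
  \int[lebesgue_measure]_(y in `[- A, A]) density (W n.+1) y =
  \int[lebesgue_measure]_(y in `[- A - h, A - h]) (W n y false ^+ 2) +
  \int[lebesgue_measure]_(y in `[- A + h, A + h]) (W n y true ^+ 2).
Proof.
move=> A0.
have c (b : bool) : continuous (fun y => W n y b ^+ 2).
  by apply: sqr_continuous; exact: walk_continuous.
have cs (b : bool) (k : R) : continuous (fun y => W n (y + k) b ^+ 2).
  move=> y; apply: (@continuous_comp _ _ _ (fun z => z + k) (fun z => W n z b ^+ 2)).
    by apply: cvgD; [exact: cvg_id|exact: cvg_cst].
  exact: c.
have AA : - A <= A by rewrite -subr_ge0 opprK addr_ge0.
rewrite (Rintegral_shift _ AA (c false)) (Rintegral_shift _ AA (c true)).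
rewrite -RintegralD//; last 2 first.
- exact: integrable_itv_continuous (cs false (- h)).
- exact: integrable_itv_continuous (cs true h).
by apply: eq_Rintegral => y _; rewrite density_walkS.
Qed.

(** The energy in [-A, A] comes from the two translated intervals, both contained
    in the enlarged one. *)
Lemma energy_walk_le n A : 0 <= A ->
  \int[lebesgue_measure]_(y in `[- A, A]) density (W n) y <=
  \int[lebesgue_measure]_(y in `[- (A + n%:R * h), A + n%:R * h]) density g y.
Proof.
elim: n A => [|n IH] A A0; first by rewrite mul0r addr0.
have c (b : bool) : continuous (fun y => W n y b ^+ 2).
  by apply: sqr_continuous; exact: walk_continuous.
have -> : A + n.+1%:R * h = (A + h) + n%:R * h by rewrite -natr1; ring.
apply: le_trans (IH _ (addr_ge0 A0 h0)).
rewrite energy_walkS// RintegralD//; [|exact: integrable_itv_continuous..].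
by apply: lerD; apply: Rintegral_subitv => //;
  first [exact: c | by move=> x; exact: sqr_ge0 | have := h0; lra].
Qed.

(** Conversely, both translates of the enlarged interval contain [-A, A]. *)
Lemma energy_walk_ge n A : 0 <= A ->
  \int[lebesgue_measure]_(y in `[- A, A]) density g y <=
  \int[lebesgue_measure]_(y in `[- (A + n%:R * h), A + n%:R * h]) density (W n) y.
Proof.
move=> A0; elim: n => [|n IH]; first by rewrite mul0r addr0.
have c (b : bool) : continuous (fun y => W n y b ^+ 2).
  by apply: sqr_continuous; exact: walk_continuous.
apply: le_trans IH _.
set B := A + n%:R * h.
have B0 : 0 <= B by rewrite addr_ge0// mulr_ge0.
have -> : A + n.+1%:R * h = B + h by rewrite /B -natr1; ring.
rewrite energy_walkS; last exact: addr_ge0.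
rewrite RintegralD//; [|exact: integrable_itv_continuous..].
by apply: lerD; apply: Rintegral_subitv => //;
  first [exact: c | by move=> x; exact: sqr_ge0 | have := h0; lra].
Qed.

End Energy.

Section Energy_psi.
Context {R : realType} d {Omega : measurableType d} {P : probability Omega R}.
Context {lambda : R} {N : R -> {RV P >-> nat}}.
Hypotheses (lambda0 : 0 < lambda) (HN : poisson_process lambda N).
Variable e : bool.
Variables (g : R -> bool -> R) (M : R).
Hypotheses (cg : forall b, continuous (g ^~ b)) (gM : forall y b, `|g y b| <= M).

Local Notation v := (real_psi (lambda := lambda) (N := N) e g).

(** On a bounded interval, bounded convergence suffices to pass to the limit in
    the energy; this is why the estimates are localized. *)
Lemma energy_cvg (t A : R) : 0 < t ->
  \int[lebesgue_measure]_(y in `[- A, A])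
     density (walk e (t / n.+1%:R) (lambda * (t / n.+1%:R)) n.+1 g) y @[n --> \oo] -->
  \int[lebesgue_measure]_(y in `[- A, A]) density (v t) y.
Proof.
move=> t0; pose h n : R := t / n.+1%:R.
have h0 n : 0 < h n by rewrite divr_gt0.
have hE n : n.+1%:R * h n = t by exact: mesh_mul.
have hc : h n @[n --> \oo] --> (0 : R) by exact: cvg_mesh.
pose C := expR (lambda * t) * M.
have C0 : 0 <= C by rewrite mulr_ge0 ?expR_ge0// (bound_ge0 gM).
apply: (proj2 (@bounded_convergence _ _ _ (@lebesgue_measure R) `[- A, A]
  (fun n => density (walk e (h n) (lambda * h n) n.+1 g)) (density (v t))
  (C ^+ 2 + C ^+ 2) _ _ _ _ _)) => //.
- exact: lebesgue_itv_lty.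
- move=> n; apply: measurable_funTS; apply: continuous_measurable_fun.
  by apply: density_continuous => b; exact: walk_continuous.
- move=> n y _; rewrite ger0_norm ?density_ge0//.
  have wC b : walk e (h n) (lambda * h n) n.+1 g y b ^+ 2 <= C ^+ 2.
    rewrite -[leLHS]real_normK ?num_real// lerXn2r// ?nnegrE//.
    by have := walk_bounded lambda0 HN e n.+1 y b (h0 n) cg gM; rewrite hE.
  exact: lerD.
- move=> y _.
  have wc b : walk e (h n) (lambda * h n) n.+1 g y b @[n --> \oo] --> v t y b.
    have := @walk_cvg _ _ _ _ _ _ lambda0 HN e g M h succn t (fun=> y) y b cg gM.
    apply=> //; first exact: ltW.
    - by move=> n; rewrite hE.
    - by under eq_fun do rewrite hE; exact: cvg_cst.
    - exact: cvg_cst.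
  by apply: cvgD; apply: cvgM; exact: wc.
Qed.

Lemma energy_psi_le (t A : R) : 0 < t -> 0 <= A ->
  \int[lebesgue_measure]_(y in `[- A, A]) density (v t) y <=
  \int[lebesgue_measure]_(y in `[- (A + t), A + t]) density g y.
Proof.
move=> t0 A0; have c := energy_cvg (A := A) t0.
rewrite -(cvg_lim (@Rhausdorff R) c); apply: limr_le.
  by apply/cvg_ex; eexists; exact: c.
apply: nearW => n.
have h0 : 0 <= t / n.+1%:R by rewrite divr_ge0// ltW.
have := energy_walk_le e (lambda * (t / n.+1%:R)) h0 cg n.+1 A0.
by rewrite mesh_mul.
Qed.

Lemma energy_psi_ge (t A : R) : 0 < t -> 0 <= A ->
  \int[lebesgue_measure]_(y in `[- A, A]) density g y <=
  \int[lebesgue_measure]_(y in `[- (A + t), A + t]) density (v t) y.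
Proof.
move=> t0 A0; have c := energy_cvg (A := A + t) t0.
rewrite -(cvg_lim (@Rhausdorff R) c); apply: limr_ge.
  by apply/cvg_ex; eexists; exact: c.
apply: nearW => n.
have h0 : 0 <= t / n.+1%:R by rewrite divr_ge0// ltW.
have := energy_walk_ge e (lambda * (t / n.+1%:R)) h0 cg n.+1 A0.
by rewrite mesh_mul.
Qed.

End Energy_psi.

Section Half_line.
Context {R : realType}.

Lemma integral_le_of_itv (F : R -> R) (c : \bar R) : continuous F ->
  (forall y, 0 <= F y) ->
  (forall A : R, 0 <= A -> ((\int[lebesgue_measure]_(y in `[- A, A]) F y)%:E <= c)%E) ->
  (\int[lebesgue_measure]_y (F y)%:E <= c)%E.
Proof.
move=> cF F0 Fc.
pose D (n : nat) : set R := `[- n%:R, n%:R]%classic.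
have mF : measurable_fun setT (EFin \o F).
  by apply/measurable_EFinP; exact: continuous_measurable_fun.
have DU : \bigcup_n D n = setT.
  apply/seteqP; split=> // y _; exists (Num.bound `|y|) => //.
  by rewrite /D /= in_itv /= -ler_norml ltW// archi_boundP.
have c1 : (\int[lebesgue_measure]_(y in D n) (F y)%:E)%E @[n --> \oo] -->
    (\int[lebesgue_measure]_(y in \bigcup_n D n) (F y)%:E)%E.
  apply: ge0_nondecreasing_set_cvg_integral => //.
  - move=> n m nm; apply/subsetPset; apply: subset_itv; rewrite bnd_simp ?lerN2 ler_nat//.
  - by move=> n; exact: measurable_itv.
  - by move=> n; apply: measurable_funTS.
  - by move=> n y _; rewrite lee_fin.
rewrite DU in c1; rewrite -(cvg_lim _ c1)//.
apply: lime_le; first by apply/cvg_ex; eexists; exact: c1.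
apply: nearW => n.
rewrite -[leLHS]fineK; first exact: Fc.
exact: integrable_fin_num (integrable_itv_continuous _ _ cF).
Qed.

(** The loss of t at both ends disappears in the limit of large intervals. *)
Lemma integral_transfer (F G : R -> R) (t : R) : 0 <= t ->
  continuous F -> (forall y, 0 <= F y) ->
  continuous G -> (forall y, 0 <= G y) ->
  (forall A : R, 0 <= A -> \int[lebesgue_measure]_(y in `[- A, A]) F y <=
    \int[lebesgue_measure]_(y in `[- (A + t), A + t]) G y) ->
  (\int[lebesgue_measure]_y (F y)%:E <= \int[lebesgue_measure]_y (G y)%:E)%E.
Proof.
move=> t0 cF F0 cG G0 FG; apply: integral_le_of_itv => // A A0.
rewrite (@le_trans _ _ (\int[lebesgue_measure]_(y in `[- (A + t), A + t]) G y)%:E)//.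
  by rewrite lee_fin FG.
rewrite fineK; last exact: integrable_fin_num (integrable_itv_continuous _ _ cG).
apply: ge0_subset_integral => //.
- by apply/measurable_EFinP; exact: continuous_measurable_fun.
- by move=> y _; rewrite lee_fin.
Qed.

End Half_line.

(** * Real and imaginary parts *)

Section Components.
Context {R : realType}.
Implicit Types (p b e : bool) (z : R[i]) (x : R).

Definition cpart p z : R := if p then complex.Im z else complex.Re z.

Lemma cpartD p z1 z2 : cpart p (z1 + z2) = cpart p z1 + cpart p z2.
Proof. by case: p z1 z2 => -[? ?] [? ?]. Qed.

Lemma cpartN p z : cpart p (- z) = - cpart p z.
Proof. by case: p z => -[? ?]. Qed.

Lemma cpartMr p z x : cpart p (z * x%:C) = cpart p z * x.
Proof. by case: p z => -[? ?] /=; rewrite mulr0 ?subr0 ?add0r. Qed.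

Lemma cpartMl p z x : cpart p (x%:C * z) = x * cpart p z.
Proof. by rewrite mulrC cpartMr mulrC. Qed.

(** Re (i z) = - Im z and Im (i z) = Re z. *)
Lemma cpart_i p z : cpart p ('i * z) = (-1) ^+ (~~ p) * cpart (~~ p) z.
Proof.
by case: p z => -[? ?] /=; rewrite mul0r mul1r ?expr0 ?expr1 ?mul1r ?mulN1r ?add0r ?sub0r.
Qed.

Lemma eq_cparts z1 z2 : (forall p, cpart p z1 = cpart p z2) -> z1 = z2.
Proof.
move: z1 z2 => [? ?] [? ?] H.
by congr Complex; [exact: (H false)|exact: (H true)].
Qed.

Lemma cpart_expi e b k z :
  cpart (~~ (b (+) e)) ('i ^+ k * z) = phase e b k * cpart (~~ (b (+) e) (+) odd k) z.
Proof.
elim: k b => [|k IH] b; first by rewrite expr0 !mul1r addbF.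
have := IH (~~ b); rewrite addNb negbK => IH'.
by rewrite exprS -mulrA cpart_i negbK IH' mulrA /= addbN addNb negbK.
Qed.

Lemma normc_sqr z : Normc.normc z ^+ 2 = cpart false z ^+ 2 + cpart true z ^+ 2.
Proof.
by case: z => a b; rewrite /Normc.normc sqr_sqrtr// addr_ge0// sqr_ge0.
Qed.

Lemma cpart_le_normc p z : `|cpart p z| <= Normc.normc z.
Proof.
rewrite -(@ler_pXn2r _ 2)// ?nnegrE//.
- rewrite normc_sqr real_normK ?num_real//.
  by case: p; rewrite ?lerDl ?lerDr sqr_ge0.
- by case: z => a b; rewrite sqrtr_ge0.
Qed.

Lemma normc_le_cparts z : Normc.normc z <= `|cpart false z| + `|cpart true z|.
Proof.
rewrite -(@ler_pXn2r _ 2)// ?nnegrE ?addr_ge0//; last first.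
  by case: z => a b; rewrite sqrtr_ge0.
rewrite normc_sqr sqrrD !real_normK ?num_real// addrAC lerDl.
by rewrite mulrn_wge0// mulr_ge0.
Qed.

Lemma complex_normE z : `|z| = (Normc.normc z)%:C.
Proof. by case: z. Qed.

Lemma cvg_cpart {T : Type} (F : set_system T) {FF : Filter F}
    (u : T -> R[i]^o) (l : R[i]) p :
  u @ F --> (l : R[i]^o) -> (fun i => cpart p (u i)) @ F --> cpart p l.
Proof.
move=> ul; apply/cvgrPdist_lt => eps eps0.
have eps0' : 0 < eps%:C by rewrite ltcR.
move/cvgrPdist_lt : ul => /(_ _ eps0'); apply: filterS => i.
rewrite complex_normE ltcR; apply: le_lt_trans.
by rewrite -cpartN -cpartD cpart_le_normc.
Qed.

Lemma cvg_of_cparts {T : Type} (F : set_system T) {FF : Filter F}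
    (u : T -> R[i]^o) (l : R[i]) :
  (forall p, (fun i => cpart p (u i)) @ F --> cpart p l) -> u @ F --> (l : R[i]^o).
Proof.
move=> ul; apply/cvgrPdist_lt => eps eps0.
have [r r0 epsE] : exists2 r : R, 0 < r & eps = r%:C.
  case: eps eps0 => a b; rewrite ltcE /= => /andP[/eqP -> a0].
  by exists a.
have r20 : 0 < r / 2 by rewrite divr_gt0.
have H p : \forall i \near F, `|cpart p l - cpart p (u i)| < r / 2.
  by have /cvgrPdist_lt := ul p; exact.
near=> i.
rewrite epsE complex_normE ltcR (le_lt_trans (normc_le_cparts _))//.
rewrite [ltRHS](splitr r) ltrD// cpartD cpartN.
- by near: i; exact: (H false).
- by near: i; exact: (H true).
Unshelve. all: by end_near. Qed.

(** Small near infinity, and bounded on the remaining segment. *)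
Lemma C0_bounded (f : R -> R[i]^o) : C0_fun f ->
  exists K, forall y p, `|cpart p (f y)| <= K.
Proof.
move=> [cf fp fn].
have cpc p : continuous (fun y => cpart p (f y)).
  by move=> y; apply: cvg_cpart; exact: cf.
have [A [Ar HA]] : \forall y \near +oo, Normc.normc (f y) < 1.
  by apply: cvgr_lt fp _ _.
have [B [Br HB]] : \forall y \near -oo, Normc.normc (f y) < 1.
  by apply: cvgr_lt fn _ _.
have [K0 K00 HK0] := @continuous_bounded_segment _ _ B A (cpc false).
have [K1 K10 HK1] := @continuous_bounded_segment _ _ B A (cpc true).
exists (K0 + K1 + 1) => y p.
have small : Normc.normc (f y) < 1 -> `|cpart p (f y)| <= K0 + K1 + 1.
  move=> fy; rewrite (le_trans (cpart_le_normc _ _))// (le_trans (ltW fy))//.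
  by rewrite lerDr addr_ge0.
have [yB|By] := ltP y B; first exact/small/HB.
have [Ay|yA] := ltP A y; first exact/small/HA.
have yBA : B <= y <= A by rewrite By.
case: p {small}.
  by rewrite (le_trans (HK1 _ yBA))// -addrA addrCA lerDl addr_ge0.
by rewrite (le_trans (HK0 _ yBA))// -addrA lerDl addr_ge0.
Qed.

End Components.

(** * The complex process *)

Section Assembly.
Context {R : realType} d {Omega : measurableType d} {P : probability Omega R}.
Context {lambda : R} {N : R -> {RV P >-> nat}}.
Hypotheses (lambda0 : 0 < lambda) (HN : poisson_process lambda N).
Variable f : R -> bool -> R[i].
Hypothesis Cf : forall b : bool, C0_fun (fun y => f y b).

(** The data of the real system e, that is, the part of each component that
    belongs to it. *)
Definition real_data (e : bool) (y : R) (b : bool) : R := cpart (~~ (b (+) e)) (f y b).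

Local Notation v e := (real_psi (lambda := lambda) (N := N) e (real_data e)).
Local Notation u := (psi lambda N f).

Lemma real_data_continuous e b : continuous (real_data e ^~ b).
Proof. by have [cf _ _] := Cf b; move=> y; apply: cvg_cpart; exact: cf. Qed.

Lemma real_data_bounded e : exists M : R, forall y b, `|real_data e y b| <= M.
Proof.
have [K0 H0] := C0_bounded (Cf false); have [K1 H1] := C0_bounded (Cf true).
exists (`|K0| + `|K1|) => y [].
  by rewrite (le_trans (H1 _ _))// (le_trans (ler_norm _))// lerDr.
by rewrite (le_trans (H0 _ _))// (le_trans (ler_norm _))// lerDl.
Qed.

(** Each jump multiplies by i, which changes the part, and changes the chirality:
    the relation between part and chirality that defines e is preserved. *)
Lemma psi_cpart_data e b t y : cpart (~~ (b (+) e)) (u t y b) = v e t y b.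
Proof.
rewrite /psi cpartMl /real_psi; congr (_ * _).
have -> p (F : Omega -> R[i]) : cpart p (cintegral P setT F) = \int[P]_w cpart p (F w).
  by case: p.
apply: eq_Rintegral => w _.
rewrite cpart_expi /flow /real_data; congr (_ * cpart _ _).
by rewrite addbAC addNb.
Qed.

Lemma psi_cpart p b t y : cpart p (u t y b) = v (~~ (b (+) p)) t y b.
Proof. by rewrite -psi_cpart_data addbN negbK addKb. Qed.

Lemma psi_initial y b : u 0 y b = f y b.
Proof.
apply: eq_cparts => p; rewrite psi_cpart (real_psi0 HN) /real_data.
by rewrite addbN negbK addKb.
Qed.

Lemma psi_continuous b : {within [set p : R * R | 0 <= p.1],
  continuous (fun p : R * R => u p.1 p.2 b : R[i]^o)}.
Proof.
pose w (q : R * R) : R[i]^o := u (Num.max 0 q.1) q.2 b.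
apply: (@subspace_eq_continuous _ _ _ w).
  by move=> q /set_mem /= q0; rewrite /w max_r.
apply: continuous_subspaceT => q; apply: cvg_of_cparts => p.
have [M HM] := real_data_bounded (~~ (b (+) p)).
under eq_fun do rewrite psi_cpart.
rewrite psi_cpart.
exact: (@psi_ext_continuous _ _ _ _ _ _ lambda0 HN _ _ _
  (@real_data_continuous (~~ (b (+) p))) HM b q).
Qed.

Lemma psi_weak phi b (D : R -> R -> R) : test_function phi ->
  (forall t y, D t y = d_t phi t y + sg b * d_y phi t y) ->
  cintegral lebesgue_measure `[0, +oo[ (fun t => cintegral lebesgue_measure setT
    (fun y => u t y b * (D t y)%:C + 'i * lambda%:C * u t y (~~ b) * (phi t y)%:C)) +
  cintegral lebesgue_measure setT (fun y => f y b * (phi 0 y)%:C) = 0.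
Proof.
move=> tphi DE; apply: eq_cparts => p.
have ciE (A : set R) (F : R -> R[i]) : cpart p (cintegral lebesgue_measure A F) =
    \int[lebesgue_measure]_(x in A) cpart p (F x).
  by case: p.
rewrite cpartD !ciE.
set e := ~~ (b (+) p).
have pE : p = ~~ (b (+) e) by rewrite /e addbN negbK addKb.
have [M HM] := real_data_bounded e.
transitivity (0 : R); last by case: (p).
rewrite -[RHS](real_weak lambda0 HN e (@real_data_continuous e) HM tphi b).
congr (_ + _); last first.
  by apply: eq_Rintegral => y _; rewrite cpartMr /real_data -pE.
apply: eq_Rintegral => t _; rewrite ciE.
apply: eq_Rintegral => y _.
rewrite cpartD !cpartMr DE -mulrA cpart_i (cpartMl _ (u t y (~~ b))); congr (_ * _ + _ * _).
  by rewrite psi_cpart.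
rewrite psi_cpart addNb addbN negbK -/e mulrA; congr (_ * _ * _).
by rewrite pE negbK.
Qed.

Lemma psi_weak_solution : weak_solution lambda f u.
Proof.
split; first exact: psi_continuous.
move=> phi tphi; split.
- by apply: psi_weak => // t y; rewrite /sg expr0 mul1r.
- by apply: psi_weak => // t y; rewrite /sg expr1 mulN1r.
Qed.

Lemma psi_classical (df : bool -> R -> R[i]^o) :
  (forall b, continuous (df b)) ->
  (forall b x, is_cderive (fun y => f y b) x (df b x)) ->
  classical_solution lambda u.
Proof.
move=> cdf fdf t y t0.
have key b p : exists l : R,
   is_derive y (1 : R) (fun x => cpart p (u t x b)) l /\
   is_derive t (1 : R) (fun s => cpart p (u s y b))
     (cpart p ('i * lambda%:C * u t y (~~ b)) - sg b * l).
  set e := ~~ (b (+) p).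
  have pE : p = ~~ (b (+) e) by rewrite /e addbN negbK addKb.
  have [M HM] := real_data_bounded e.
  pose dg (x : R) (c : bool) : R := cpart (~~ (c (+) e)) (df c x).
  have cdg c : continuous (dg ^~ c) by move=> x; apply: cvg_cpart; exact: cdf.
  have gdg (x : R) c : is_derive x (1 : R) (real_data e ^~ c) (dg x c).
    by have [Hre Him] := fdf c x; rewrite /real_data /dg; case: (~~ _).
  have [l [l1 l2]] := real_classical lambda0 HN e (@real_data_continuous e) HM cdg gdg y b t0.
  exists l; split.
    by under eq_fun do rewrite psi_cpart.
  rewrite -mulrA cpart_i (cpartMl _ (u t y (~~ b))) psi_cpart.
  rewrite (_ : (-1) ^+ (~~ p) = turn e b); last by rewrite pE negbK.
  rewrite addNb addbN negbK -/e mulrA.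
  by under eq_fun do rewrite psi_cpart.
have key2 b : exists dty : R[i] * R[i],
   [/\ is_cderive (fun s => u s y b) t dty.1,
       is_cderive (fun x => u t x b) y dty.2 &
       dty.1 = - (sg b)%:C * dty.2 + 'i * lambda%:C * u t y (~~ b)].
  have [l0 [x0 s0]] := key b false; have [l1 [x1 s1]] := key b true.
  pose w := 'i * lambda%:C * u t y (~~ b).
  exists ((cpart false w - sg b * l0) +i* (cpart true w - sg b * l1), l0 +i* l1); split => //=.
  apply: eq_cparts => p; rewrite cpartD -rmorphN cpartMl.
  by case: p => /=; rewrite mulNr addrC.
have [[dt0 dy0] /= [A0 B0 C0]] := key2 false.
have [[dt1 dy1] /= [A1 B1 C1]] := key2 true.
exists (fun b => if b then dt1 else dt0), (fun b => if b then dy1 else dy0).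
split.
- by case.
- by case.
- by rewrite C0 /sg expr0 mulN1r.
- by rewrite C1 /sg expr1 rmorphN1 opprK mul1r.
Qed.

(** The squared moduli sum up the energies of the two real systems. *)
Lemma psi_energy t : 0 < t ->
  (\int[lebesgue_measure]_y
     (Normc.normc (u t y false) ^+ 2 + Normc.normc (u t y true) ^+ 2)%:E =
   \int[lebesgue_measure]_y
     (Normc.normc (f y false) ^+ 2 + Normc.normc (f y true) ^+ 2)%:E)%E.
Proof.
move=> t0.
pose F y := density (real_data false) y + density (real_data true) y.
pose G y := density (v false t) y + density (v true t) y.
have FE y : Normc.normc (f y false) ^+ 2 + Normc.normc (f y true) ^+ 2 = F y.
  by rewrite !normc_sqr /F /density /real_data /=; ring.
have GE y : Normc.normc (u t y false) ^+ 2 + Normc.normc (u t y true) ^+ 2 = G y.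
  by rewrite !normc_sqr !psi_cpart /G /density /=; ring.
under eq_integral do rewrite GE; under [RHS]eq_integral do rewrite FE.
have cv e b : continuous (v e t ^~ b).
  have [M HM] := real_data_bounded e.
  exact: (@real_psi_continuous_space _ _ _ _ _ _ HN e _ M t b (ltW t0)
    (@real_data_continuous e) HM).
have cF e : continuous (density (real_data e)).
  by apply: density_continuous => b; exact: real_data_continuous.
have cG e : continuous (density (v e t)) by apply: density_continuous.
have cF' : continuous F by move=> y; apply: cvgD; exact: cF.
have cG' : continuous G by move=> y; apply: cvgD; exact: cG.
have F0 y : 0 <= F y by rewrite addr_ge0 ?density_ge0.
have G0 y : 0 <= G y by rewrite addr_ge0 ?density_ge0.
have [M0 HM0] := real_data_bounded false; have [M1 HM1] := real_data_bounded true.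
have split_int (F1 F2 : R -> R) (a b : R) : continuous F1 -> continuous F2 ->
    \int[lebesgue_measure]_(y in `[a, b]) (F1 y + F2 y) =
    \int[lebesgue_measure]_(y in `[a, b]) F1 y +
    \int[lebesgue_measure]_(y in `[a, b]) F2 y.
  by move=> c1 c2; rewrite RintegralD//; exact: integrable_itv_continuous.
apply/eqP; rewrite eq_le; apply/andP.
split; apply: (integral_transfer (ltW t0)) => // A A0.
- rewrite (split_int _ _ _ _ (cG false) (cG true)).
  rewrite (split_int _ _ _ _ (cF false) (cF true)).
  apply: lerD.
    exact: (energy_psi_le lambda0 HN _ (@real_data_continuous false) HM0).
  exact: (energy_psi_le lambda0 HN _ (@real_data_continuous true) HM1).
- rewrite (split_int _ _ _ _ (cG false) (cG true)).
  rewrite (split_int _ _ _ _ (cF false) (cF true)).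
  apply: lerD.
    exact: (energy_psi_ge lambda0 HN _ (@real_data_continuous false) HM0).
  exact: (energy_psi_ge lambda0 HN _ (@real_data_continuous true) HM1).
Qed.

End Assembly.

Theorem proposition4p3 (R : realType) (d : measure_display)
    (Omega : measurableType d) (P : probability Omega R)
    (lambda : R) (N : R -> {RV P >-> nat}) (f : R -> bool -> R[i]) :
  0 < lambda ->
  poisson_process lambda N ->
  (forall b : bool, C0_fun (fun y => f y b)) ->
  [/\ weak_solution lambda f (psi lambda N f),
      (forall b : bool, C1_fun (fun y => f y b)) ->
        classical_solution lambda (psi lambda N f),
      forall (y : R) (b : bool), psi lambda N f 0 y b = f y b &
      (\int[lebesgue_measure]_y
         (Normc.normc (f y false) ^+ 2 + Normc.normc (f y true) ^+ 2)%:E = 1)%E ->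
      forall t : R, 0 < t ->
      (\int[lebesgue_measure]_y
         (Normc.normc (psi lambda N f t y false) ^+ 2 +
          Normc.normc (psi lambda N f t y true) ^+ 2)%:E = 1)%E].
Proof.
move=> lambda0 HN Cf; split.
- exact: psi_weak_solution.
- move=> C1.
  have [d0 c0 D0] := C1 false; have [d1 c1 D1] := C1 true.
  by apply: (psi_classical lambda0 HN Cf (df := fun b => if b then d1 else d0)); case.
- by move=> y b; exact: psi_initial.
- by move=> f1 t t0; rewrite psi_energy.
Qed.
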